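(* Fix $\vec z\in\mathbb{R}^*$, and let $\mathbb{I}_{\vec z}:=\{\vec x\in\mathbb{R}^*:\text{the entries of }\vec x\text{ are algebraically independent over }\mathbb{Q}(\vec z)\}$, $\mathbb{S}^{d}_{\vec z}:=\{(\vec x,k)\in\mathbb{R}^*\times\mathbb{N}:\mathrm{K}^{d}_{\vec z}(\vec x)\leq k\}$, and let $C\subseteq[0,1]$ be the Cantor middle-third set, i.e. the set of all $\sum_{n=1}^\infty t_n3^{-n}$ with $t_n\in\{0,2\}$. Then: (a) $\mathbb{S}^{d}_{\vec z}$ is BSS decidable relative to $\mathbb{I}_{\vec z}$, and $\mathbb{I}_{\vec z}$ is BSS decidable relative to $\mathbb{S}^{d}_{\vec z}$; (b) the complement of $C$ is BSS semi-decidable; (c) $C$ is not BSS semi-decidable, even relative to the oracle $\mathbb{I}_{\vec z}$; (d) the real Halting problem $\mathbb{H}$ is not BSS decidable relative to $\mathbb{S}^{d}_{\vec z}$, nor relative to the function $\mathrm{K}^{d}_{\vec z}$.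
   Context: A BSS machine computes over $(\mathbb{R},+,-,\times,\div,<)$ with finitely many real constants, branching on signs; it computes a partial function $\mathbb{R}^*\to\mathbb{R}^*$, $\mathbb{R}^*=\bigcup_{n\ge0}\mathbb{R}^n$, $\operatorname{size}(\vec x)=n$ for $\vec x\in\mathbb{R}^n$. It decides $L\subseteq\mathbb{R}^*$ if it computes its characteristic function, and semi-decides $L$ if $L$ is exactly the set of inputs on which it halts. A BSS oracle machine with oracle $O\subseteq\mathbb{R}^*$ may additionally query membership of a vector in $O$ and branch on the answer (relative to a function, it may query its values). BSS machines can be encoded as real vectors $\langle M\rangle$; the real Halting problem is $\mathbb{H}=\{\langle M\rangle: M\text{ terminates on the empty input}\}$. Fix $\vec z=(z_1,\ldots,z_D)$. A machine $M$ with control $\delta$ (discrete) referring to own constants $c_1,\ldots,c_J$ and host constants $z_1,\ldots,z_D$ is encoded as $\langle M\rangle_{\vec z}:=(\langle\delta,c_1\rangle,c_2,\ldots,c_J)$ using a BSS-computable injective pairing $\mathbb{N}\times\mathbb{R}\to\mathbb{R}$ with computable inverse; $\mathbb{U}_{\vec z}$ is a universal BSS machine with constants $\vec z$ simulating encoded machines. $\mathrm{K}^{d}_{\vec z}(\vec x)$ is the minimum $\operatorname{size}(\vec p)$ over $\vec p\in\mathbb{R}^*$ such that $\mathbb{U}_{\vec z}$ with program $\vec p$ decides the language $\{\vec x\}$. *)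

(* Defs.v *)
From HB Require Import structures.
From mathcomp Require Import all_boot all_order all_algebra.
From mathcomp Require Import all_classical all_reals all_analysis.
(* The notations of mpoly clash with those of mathcomp-analysis. *)
From mathcomp Require Import -(notations) mpoly.

Set Implicit Arguments.
Unset Strict Implicit.
Unset Printing Implicit Defensive.

Import Order.TTheory GRing.Theory Num.Theory.
Import numFieldNormedType.Exports.

Local Open Scope classical_set_scope.
Local Open Scope ring_scope.

(* A machine has real work registers, natural-number index registers, and an
   infinite sequence of real cells that is addressed through index registers.
   A program (control) mentions only finitely many registers. It contains no
   real constants except 0 (unused registers) and 1; all other constants are
   referred to by their position in a list that is supplied separately.
   R^* is [seq R]. *)

Inductive arith := Add | Sub | Mul | Div.

Inductive constant := One | Own of nat | Host of nat.

Inductive instr :=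
| Arith of arith & nat & nat & nat (* reg d := reg a op reg b *)
| Const of nat & constant          (* reg d := constant *)
| Fetch of nat & nat                (* reg d := mem (idx i) *)
| Store of nat & nat               (* mem (idx i) := reg a *)
| IdxCopy of nat & nat             (* idx i := idx j *)
| IdxInc of nat                    (* idx i := idx i + 1 *)
| IdxDec of nat                    (* idx i := idx i - 1, truncated at 0 *)
| JumpLt of nat & nat & nat        (* if reg a < reg b go to l *)
| JumpIdxLe of nat & nat & nat.    (* if idx i <= idx j go to l *)

Definition control := seq instr.

(* Query i j replaces the vector v held by the cells idx i, ..., idx j - 1
   with the oracle's answer on v, and sets idx j to the end of the answer. *)
Inductive oinstr := Plain of instr | Query of nat & nat.

Definition ocontrol := seq oinstr.

(* A Goedel numbering of controls: [pickle : control -> nat]. *)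
Definition instr_code (i : instr) : seq nat :=
  match i with
  | Arith Add d a b => [:: 0; d; a; b]
  | Arith Sub d a b => [:: 1; d; a; b]
  | Arith Mul d a b => [:: 2; d; a; b]
  | Arith Div d a b => [:: 3; d; a; b]
  | Const d One => [:: 4; d]
  | Const d (Own k) => [:: 5; d; k]
  | Const d (Host k) => [:: 6; d; k]
  | Fetch d i => [:: 7; d; i]
  | Store i a => [:: 8; i; a]
  | IdxCopy i j => [:: 9; i; j]
  | IdxInc i => [:: 10; i]
  | IdxDec i => [:: 11; i]
  | JumpLt a b l => [:: 12; a; b; l]
  | JumpIdxLe i j l => [:: 13; i; j; l]
  end%N.

Definition instr_decode (s : seq nat) : option instr :=
  match s with
  | [:: 0; d; a; b] => Some (Arith Add d a b)
  | [:: 1; d; a; b] => Some (Arith Sub d a b)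
  | [:: 2; d; a; b] => Some (Arith Mul d a b)
  | [:: 3; d; a; b] => Some (Arith Div d a b)
  | [:: 4; d] => Some (Const d One)
  | [:: 5; d; k] => Some (Const d (Own k))
  | [:: 6; d; k] => Some (Const d (Host k))
  | [:: 7; d; i] => Some (Fetch d i)
  | [:: 8; i; a] => Some (Store i a)
  | [:: 9; i; j] => Some (IdxCopy i j)
  | [:: 10; i] => Some (IdxInc i)
  | [:: 11; i] => Some (IdxDec i)
  | [:: 12; a; b; l] => Some (JumpLt a b l)
  | [:: 13; i; j; l] => Some (JumpIdxLe i j l)
  | _ => None
  end%N.

Lemma instr_codeK : pcancel instr_code instr_decode.
Proof. by case=> [[]|? []|||||||]. Qed.

HB.instance Definition _ := Countable.copy instr (pcan_type instr_codeK).

Section Machines.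
Variable R : realType.

Record config := Config {
  pc : nat;
  reg : nat -> R;
  idx : nat -> nat;
  mem : nat -> R }.

(* The input occupies the first cells, its size is in index register 0;
   the output is read off in the same way. *)
Definition init (x : seq R) : config :=
  Config 0 (fun=> 0) [eta (fun=> 0%N) with 0%N |-> size x] (nth 0 x).

Definition segment (m : nat -> R) (i j : nat) : seq R :=
  [seq m k | k <- index_iota i j].

Definition output (s : config) : seq R := segment (mem s) 0 (idx s 0).

Definition overwrite (m : nat -> R) (i : nat) (v : seq R) : nat -> R :=
  fun k => if (i <= k < i + size v)%N then nth 0 v (k - i) else m k.

Definition const_val (own host : seq R) (c : constant) : R :=
  match c with One => 1 | Own k => nth 0 own k | Host k => nth 0 host k end.

Definition arith_val (op : arith) (x y : R) : option R :=
  match op with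
  | Add => Some (x + y)
  | Sub => Some (x - y)
  | Mul => Some (x * y)
  | Div => if y == 0 then None else Some (x / y)
  end.

(* An instruction whose result is undefined is repeated forever. *)
Definition step_instr (own host : seq R) (ins : instr) (s : config) : config :=
  let: Config p r ix m := s in
  match ins with
  | Arith op d a b =>
      if arith_val op (r a) (r b) is Some v
      then Config p.+1 [eta r with d |-> v] ix m else s
  | Const d c => Config p.+1 [eta r with d |-> const_val own host c] ix m
  | Fetch d i => Config p.+1 [eta r with d |-> m (ix i)] ix m
  | Store i a => Config p.+1 r ix [eta m with ix i |-> r a]
  | IdxCopy i j => Config p.+1 r [eta ix with i |-> ix j] m
  | IdxInc i => Config p.+1 r [eta ix with i |-> (ix i).+1] m
  | IdxDec i => Config p.+1 r [eta ix with i |-> (ix i).-1] m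
  | JumpLt a b l => Config (if r a < r b then l else p.+1) r ix m
  | JumpIdxLe i j l => Config (if (ix i <= ix j)%N then l else p.+1) r ix m
  end.

(* Oracles are partial functions; sets are queried through their
   characteristic functions. *)
Definition oracle := seq R -> option (seq R).

Definition charfun (L : set (seq R)) (x : seq R) : seq R :=
  [:: if `[< L x >] then 1 else 0].

Definition set_oracle (L : set (seq R)) : oracle := fun x => Some (charfun L x).

Definition natfun_oracle (f : seq R -> option nat) : oracle :=
  fun x => omap (fun k => [:: k%:R]) (f x).

Definition no_oracle : oracle := fun=> None.

Definition step_oinstr (O : oracle) (own host : seq R) (ins : oinstr)
    (s : config) : config :=
  match ins with
  | Plain i => step_instr own host i s
  | Query i j =>
      let: Config p r ix m := s in
      if O (segment m (ix i) (ix j)) is Some v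
      then Config p.+1 r [eta ix with j |-> (ix i + size v)%N]
             (overwrite m (ix i) v)
      else s
  end.

Definition step (O : oracle) (P : ocontrol) (own host : seq R) (s : config) :=
  if onth P (pc s) is Some ins then step_oinstr O own host ins s else s.

Definition run (O : oracle) (P : ocontrol) (own host : seq R) (x : seq R)
    (t : nat) : config :=
  iter t (step O P own host) (init x).

Definition halts_in (O : oracle) (P : ocontrol) (own host x : seq R) : Prop :=
  exists t, (size P <= pc (run O P own host x t))%N.

Definition returns_in (O : oracle) (P : ocontrol) (own host x y : seq R) :
    Prop :=
  exists2 t, (size P <= pc (run O P own host x t))%N &
             output (run O P own host x t) = y.

Definition halts (M : control) (own host x : seq R) : Prop :=
  halts_in no_oracle (map Plain M) own host x.

Definition returns (M : control) (own host x y : seq R) : Prop :=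
  returns_in no_oracle (map Plain M) own host x y.

Definition bss_decidable_in (O : oracle) (L : set (seq R)) : Prop :=
  exists (P : ocontrol) (c : seq R),
    forall x, returns_in O P c [::] x (charfun L x).

Definition bss_semidecidable_in (O : oracle) (L : set (seq R)) : Prop :=
  exists (P : ocontrol) (c : seq R),
    forall x, L x <-> halts_in O P c [::] x.

Definition bss_semidecidable (L : set (seq R)) : Prop :=
  exists (M : control) (c : seq R),
    forall x, L x <-> halts M c [::] x.

(* Pairings need not be surjective, and nothing is required of the machine
   computing the inverse outside the range. *)
Record bss_pairing (pair : nat -> R -> R) : Prop := BssPairing {
  pairing_inj : forall m n x y, pair m x = pair n y -> m = n /\ x = y;
  pairing_computable : exists (M : control) (c : seq R),
    forall n x, returns M c [::] [:: n%:R; x] [:: pair n x];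
  pairing_inv_computable : exists (M : control) (c : seq R),
    forall n x, returns M c [::] [:: pair n x] [:: n%:R; x] }.

(* (<delta, c_1>, c_2, ..., c_J). A machine without own constants is given the
   dummy constant c_1 = 0, which does not change its behaviour since missing
   constants are read as 0. *)
Definition encode (pair : nat -> R -> R) (delta : control) (c : seq R) :
    seq R :=
  pair (pickle delta) (head 0 c) :: behead c.

(* The pair (p, x) of vectors as a single vector *)
Definition program_input (p x : seq R) : seq R := (size p)%:R :: p ++ x.

(* U, with z as its only constants, simulates every encoded machine with host
   constants z; its behaviour on programs that encode no machine is left open. *)
Definition universal (pair : nat -> R -> R) (z : seq R) (U : control) : Prop :=
  forall (delta : control) (c x y : seq R),
    returns U [::] z (program_input (encode pair delta c) x) y <->
    returns delta c z x y.

Definition halting_problem (pair : nat -> R -> R) : set (seq R) :=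
  [set v | exists (delta : control) (c : seq R),
     v = encode pair delta c /\ halts delta c [::] [::]].

Definition program_decides (U : control) (z p : seq R) (L : set (seq R)) :
    Prop :=
  forall w, returns U [::] z (program_input p w) (charfun L w).

(* The least size of an element of P, None if P is empty *)
Definition min_size (P : set (seq R)) : option nat :=
  match pselect (exists n, `[< exists2 p, P p & size p = n >]) with
  | left h => Some (ex_minn h)
  | right _ => None
  end.

Definition Kd (U : control) (z x : seq R) : option nat :=
  min_size [set p | program_decides U z p [set x]].

(* (x, k) is the vector x followed by the entry k *)
Definition Sd (U : control) (z : seq R) : set (seq R) :=
  [set v | exists (x : seq R) (k m : nat),
     [/\ v = rcons x k%:R, Kd U z x = Some m & (m <= k)%N]].

(* The field Q(z) *)
Definition rat_adjoin (z : seq R) : set R :=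
  [set r | forall S : {pred R},
     GRing.divring_closed S -> {subset z <= S} -> r \in S].

Definition alg_independent (K : set R) (x : seq R) : Prop :=
  forall P : mpoly (size x) R,
    (forall m, K (mcoeff m P)) ->
    meval (fun i : 'I_(size x) => nth 0 x i) P = 0 -> P = 0.

Definition Ind (z : seq R) : set (seq R) :=
  [set x | alg_independent (rat_adjoin z) x].

Definition cantor_third : set R :=
  [set x | exists2 t : nat -> R, (forall n, t n = 0 \/ t n = 2) &
     (fun N => \sum_(1 <= n < N.+1) t n * 3 ^- n) @ \oo --> x].

(* Subsets of R as subsets of R^1 *)
Definition lang1 (A : set R) : set (seq R) := [set [:: r] | r in A].

End Machines.

(* Main.v *)
Require Import Defs.
From HB Require Import structures.
From mathcomp Require Import all_boot all_order all_algebra.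
From mathcomp Require Import all_classical all_reals all_analysis.
From mathcomp Require Import -(notations) mpoly.
From mathcomp Require Import ring lra zify.

Set Implicit Arguments.
Unset Strict Implicit.
Unset Printing Implicit Defensive.

Import Order.TTheory GRing.Theory Num.Theory.
Import numFieldNormedType.Exports.

Local Open Scope classical_set_scope.
Local Open Scope ring_scope.

(** A terminating run performs finitely many tests on rational functions of the
    input [x] and of the constants. Hence every [w] close enough to [x] that satisfies one
    suitable polynomial equation satisfied by [x] follows the same path. A point whose
    coordinates are not all algebraic over the field of constants is not an isolated
    zero of any such equation, so a program [p] deciding [{x}] makes [x] algebraic over
    [Q(z, p)], and Steinitz' exchange lemma gives [trdeg x <= size p]. Conversely a
    transcendence basis of [x], taken as own constants, lets a machine decide [{x}] by
    isolating each coordinate as a root. So [Kd x = max(1, trdeg x)], except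
    that the empty program may decide one singleton, for which [Kd] is 0.

    (a) A transcendence basis is found greedily with queries to [Ind]. In the other direction,
    a vector of size [n >= 2] is dependent iff [Kd <= n - 1]; a single number
    [a] is transcendental over [Q(z)] iff [(a, c1)] or [(a, c2)] is independent, where
    [c1, c2] are fixed numbers independent over [Q(z)].

    (c), (d) Choose [x] in the Cantor set and transcendental over all constants. The
    transcendental [w] close to [x] follow the path of [x], also through the queries, because
    [Q(x)] and [Q(w)] are isomorphic over the constants. But some of them are outside
    the Cantor set. For (d) the machine is given the code of a program that halts iff its
    own constant [x] is outside the Cantor set. *)

(** * Polynomials with integer coefficients *)

(** No field isomorphism is ever built. Everything over Q(D) is expressed through integer
    polynomials evaluated at [D ++ x]. The syntax [pexp] can be evaluated in R, in R[X] and in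
    [mpoly], is countable, and can be compiled into machine code. An equation satisfied by [x] may
    well have [x] as an isolated zero, as a sum of squares shows; this is why a run near [x] says
    nothing without an argument on algebraic dependence. The maximum with 1 arises because a code
    stores its control and its first constant in the same real. Hence [Kd] does not separate the
    transcendence degrees 0 and 1, which forces the detour for single numbers in (a). The vector
    with [Kd] equal to 0 is harmless in (d) once its entries are counted among the constants: a
    vector conjugate to it over them is equal to it. *)

Inductive pexp :=
| PVar of nat
| POne
| PSub of pexp & pexp
| PMul of pexp & pexp.

Fixpoint pexp_encode (e : pexp) : GenTree.tree nat :=
  match e with
  | PVar i => GenTree.Leaf i
  | POne => GenTree.Node 0 [::]
  | PSub a b => GenTree.Node 1 [:: pexp_encode a; pexp_encode b]
  | PMul a b => GenTree.Node 2 [:: pexp_encode a; pexp_encode b]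
  end.

Fixpoint pexp_decode (t : GenTree.tree nat) : pexp :=
  match t with
  | GenTree.Leaf i => PVar i
  | GenTree.Node 1 [:: a; b] => PSub (pexp_decode a) (pexp_decode b)
  | GenTree.Node 2 [:: a; b] => PMul (pexp_decode a) (pexp_decode b)
  | _ => POne
  end.

Lemma pexp_encodeK : cancel pexp_encode pexp_decode.
Proof. by elim=> //= a -> b ->. Qed.

HB.instance Definition _ := Countable.copy pexp (can_type pexp_encodeK).

Definition PZero := PSub POne POne.
Definition PAdd a b := PSub a (PSub PZero b).
Definition PSum (l : seq pexp) := foldr PAdd PZero l.

Section PExp.
Variable A : nzRingType.

Fixpoint peval (s : seq A) (e : pexp) : A :=
  match e with
  | PVar i => s`_i
  | POne => 1
  | PSub a b => peval s a - peval s b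
  | PMul a b => peval s a * peval s b
  end.

Lemma pevalZero s : peval s PZero = 0.
Proof. by rewrite /= subrr. Qed.

Lemma pevalAdd s a b : peval s (PAdd a b) = peval s a + peval s b.
Proof. by rewrite /= subrr sub0r opprK. Qed.

Lemma pevalSum s l : peval s (PSum l) = \sum_(e <- l) peval s e.
Proof.
elim: l => [|e l IH]; first by rewrite big_nil pevalZero.
by rewrite big_cons -IH -pevalAdd.
Qed.

End PExp.

Arguments pevalZero {A}.

Lemma peval_rmorph (A B : nzRingType) (f : {rmorphism A -> B}) s e :
  peval (map f s) e = f (peval s e).
Proof.
elim: e => [i||a IHa b IHb|a IHa b IHb] /=; last 2 first.
- by rewrite IHa IHb rmorphB.
- by rewrite IHa IHb rmorphM.
- case: (ltnP i (size s)) => h; first by rewrite (nth_map 0).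
  by rewrite !nth_default ?rmorph0 ?size_map.
by rewrite rmorph1.
Qed.

Fixpoint prename (f : nat -> nat) (e : pexp) : pexp :=
  match e with
  | PVar i => PVar (f i)
  | POne => POne
  | PSub a b => PSub (prename f a) (prename f b)
  | PMul a b => PMul (prename f a) (prename f b)
  end.

Lemma peval_rename (A : nzRingType) (s s' : seq A) f e :
  (forall i, s`_(f i) = s'`_i) -> peval s (prename f e) = peval s' e.
Proof. by move=> h; elim: e => //= a -> b ->. Qed.

Fixpoint pnat (n : nat) : pexp := if n is n'.+1 then PAdd POne (pnat n') else PZero.

Lemma peval_nat (A : nzRingType) (s : seq A) n : peval s (pnat n) = n%:R.
Proof.
by elim: n => [|n IH]; rewrite ?pevalZero //= subrr sub0r opprK IH mulrS.
Qed.

(* The variables of index at least [n] read 0 in a valuation of size [n]; the one of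
   index [n] would be captured when the valuation is extended. *)
Definition plift (n : nat) := prename (fun i => if (i < n)%N then i else i.+1).

Lemma peval_lift (A : nzRingType) (s : seq A) t e :
  peval (rcons s t) (plift (size s) e) = peval s e.
Proof.
apply: peval_rename => i; rewrite nth_rcons.
case: (ltnP i (size s)) => h; first by rewrite h.
by rewrite ltnNge leqW //= gtn_eqF // nth_default.
Qed.

(** Appending [m] entries must leave the out-of-range variables reading 0, hence the shift. *)
Definition ptrunc (n m : nat) := prename (fun i => if (i < n)%N then i else (i + m)%N).

Lemma peval_trunc (A : nzRingType) (s s' : seq A) e :
  peval (s ++ s') (ptrunc (size s) (size s') e) = peval s e.
Proof.
apply: peval_rename => i; rewrite nth_cat.
case: (ltnP i (size s)) => h; first by rewrite h.
rewrite ltnNge (leq_trans h) ?leq_addr //=.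
by rewrite !nth_default // -addnBAC // leq_addl.
Qed.

(* [pcoef n e j] is the coefficient of the [j]-th power of the variable [n]. *)
Fixpoint pcoef (n : nat) (e : pexp) (j : nat) : pexp :=
  match e with
  | PVar i => if i == n then (if j == 1%N then POne else PZero)
              else if j == 0%N then PVar i else PZero
  | POne => if j == 0%N then POne else PZero
  | PSub a b => PSub (pcoef n a j) (pcoef n b j)
  | PMul a b => PSum [seq PMul (pcoef n a i) (pcoef n b (j - i)) | i <- iota 0 j.+1]
  end.

(** Converse of [pcoef]. The coefficients are lifted so that their out-of-range variable [n] is not
    captured by the main variable. *)
Definition phorner (n : nat) (l : seq pexp) : pexp :=
  foldr (fun c acc => PAdd (PMul acc (PVar n)) (plift n c)) PZero l.

Section UPoly.
Variable R : comNzRingType.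
Implicit Types (S : seq R) (e : pexp).

Definition upoly S e : {poly R} := peval (rcons (map polyC S) 'X) e.

Lemma horner_upoly S e t : (upoly S e).[t] = peval (rcons S t) e.
Proof.
rewrite /upoly; elim: e => [i||a IHa b IHb|a IHa b IHb] /=; last 2 first.
- by rewrite hornerD hornerN IHa IHb.
- by rewrite hornerM IHa IHb.
- rewrite !nth_rcons size_map; case: ltnP => h.
    by rewrite (nth_map 0) // hornerC.
  by case: ifP => _; rewrite ?hornerX ?horner0.
by rewrite hornerC.
Qed.

Lemma pcoefM S n a b j : peval S (pcoef n (PMul a b) j) =
  \sum_(i < j.+1) peval S (pcoef n a i) * peval S (pcoef n b (j - i)).
Proof.
have -> : pcoef n (PMul a b) j =
    PSum [seq PMul (pcoef n a i) (pcoef n b (j - i)) | i <- iota 0 j.+1] by [].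
rewrite pevalSum.
rewrite big_map -(big_mkord xpredT (fun i =>
  peval S (pcoef n a i) * peval S (pcoef n b (j - i)))).
by rewrite /index_iota subn0.
Qed.

Lemma coef_upoly S e j :
  (upoly S e)`_j = peval S (pcoef (size S) e j).
Proof.
rewrite /upoly; elim: e j => [i||a IHa b IHb|a IHa b IHb] j; last 2 first.
- by rewrite /= coefB IHa IHb.
- rewrite coefM -[RHS]/(peval S (pcoef (size S) (PMul a b) j)) pcoefM.
  by apply: eq_bigr => i _; rewrite IHa IHb.
- rewrite /= nth_rcons size_map; case: ltngtP => h.
  + rewrite (nth_map 0) // coefC; case: eqP => // _; by rewrite pevalZero.
  + rewrite coef0; case: ifP => _; rewrite ?pevalZero //= nth_default //.
    exact: ltnW.
  + rewrite coefX; case: eqP => // _; by rewrite pevalZero.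
by rewrite /= coefC; case: eqP => // _; rewrite pevalZero.
Qed.

Lemma upoly_horner S l : upoly S (phorner (size S) l) = Poly (map (peval S) l).
Proof.
elim: l => [|c l IH]; first by rewrite /= /upoly pevalZero.
rewrite /= cons_poly_def -IH /upoly pevalAdd /=; congr (_ * _ + _).
  by rewrite nth_rcons size_map ltnn eqxx.
have := peval_lift (map polyC S) 'X c; rewrite size_map => ->.
exact: peval_rmorph.
Qed.

End UPoly.

(** * Algebraic elements over finitely generated fields *)

Section RationalValues.
Variable R : fieldType.
Implicit Types (S : seq R) (e : pexp).

(** The field Q(S), with explicit numerators and denominators so that the latter can be cleared. *)
Definition ratv S : {pred R} := [pred r |
  `[< exists n d, peval S d != 0 /\ r = peval S n / peval S d >] ].

Lemma ratvP S r :
  reflect (exists n d, peval S d != 0 /\ r = peval S n / peval S d) (r \in ratv S).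
Proof. exact: asboolP. Qed.

Lemma peval_ratv S e : peval S e \in ratv S.
Proof. by apply/ratvP; exists e, POne; rewrite /= oner_neq0 divr1. Qed.

Lemma mem_ratv S : {subset S <= ratv S}.
Proof. by move=> r /(nthP 0)[i _ <-]; exact: (peval_ratv S (PVar i)). Qed.

Lemma ratv_divring_closed S : GRing.divring_closed (ratv S).
Proof.
split; first exact: (peval_ratv S POne).
  move=> _ _ /ratvP[n1 [d1 [h1 ->]]] /ratvP[n2 [d2 [h2 ->]]].
  apply/ratvP; exists (PSub (PMul n1 d2) (PMul n2 d1)), (PMul d1 d2).
  rewrite /= mulf_neq0 //; split=> //.
  by rewrite -mulNr addf_div // mulNr.
move=> _ _ /ratvP[n1 [d1 [h1 ->]]] /ratvP[n2 [d2 [h2 ->]]].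
have [h|h] := eqVneq (peval S n2) 0.
  by rewrite h mul0r invr0 mulr0 -(pevalZero S) peval_ratv.
apply/ratvP; exists (PMul n1 d2), (PMul d1 n2); rewrite /= mulf_neq0 //; split=> //.
by rewrite invf_div mulf_div.
Qed.

HB.instance Definition _ S :=
  GRing.isDivringClosed.Build R (ratv S) (ratv_divring_closed S).

Lemma common_denominator S (l : seq R) : {subset l <= ratv S} ->
  exists (d : pexp) (es : seq pexp),
    peval S d != 0 /\ map (peval S) es = [seq peval S d * r | r <- l].
Proof.
elim: l => [|r l IH] h; first by exists POne, [::]; rewrite /= oner_neq0.
have [|d [es [d0 hes]]] := IH; first by move=> y yl; apply: h; rewrite inE yl orbT.
have /ratvP[n [d' [d'0 ->]]] := h r (mem_head _ _).
exists (PMul d d'), (PMul d n :: [seq PMul d' e | e <- es]).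
rewrite /= mulf_neq0 // mulrACA divff // mulr1; split => //; congr (_ :: _).
rewrite -map_comp (@eq_map _ _ _ ( *%R (peval S d') \o peval S)) //.
by rewrite map_comp hes -map_comp; apply: eq_map => y /=; rewrite mulrCA mulrA.
Qed.

(** Q(S) as a field type of its own, which gives access to [algebraicOver] and to polynomial
    division. *)
Record ratT S := RatT { rat_val : R; _ : rat_val \in ratv S }.
HB.instance Definition _ S := [isSub for @rat_val S].
HB.instance Definition _ S := [Choice of ratT S by <:].
HB.instance Definition _ S := [SubChoice_isSubComUnitRing of ratT S by <:].
HB.instance Definition _ S := [SubComUnitRing_isSubIntegralDomain of ratT S by <:].
HB.instance Definition _ S := [SubIntegralDomain_isSubField of ratT S by <:].

(** The coefficients are polynomials in [S], not rational functions; by [inalgP] this is the usual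
    notion. The second condition rules out relations that hold for every [y]. *)
Definition inalg S (y : R) := exists2 e, peval (rcons S y) e = 0 & upoly S e != 0.

Lemma upoly_lift S e : exists p : {poly ratT S}, upoly S e = map_poly val p.
Proof.
pose c j := RatT (peval_ratv S (pcoef (size S) e j)).
exists (\poly_(j < size (upoly S e)) c j); apply/polyP => j.
rewrite coef_map coef_poly; case: ltnP => h; last by rewrite nth_default ?rmorph0.
by rewrite coef_upoly.
Qed.

Lemma upoly_lower S (p : {poly ratT S}) :
  exists d e, peval S d != 0 /\ upoly S e = peval S d *: map_poly val p.
Proof.
have [|d [es [d0 hes]]] := @common_denominator S (map_poly val p).
  move=> r /(nthP 0)[i _ <-]; rewrite coef_map /=; exact: valP.
exists d, (phorner (size S) es); split=> //.
rewrite upoly_horner hes; apply/polyP => i; rewrite coef_Poly coefZ.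
case: (ltnP i (size (map_poly val p))) => h; first by rewrite (nth_map 0).
by rewrite !nth_default ?mulr0 ?size_map.
Qed.

Lemma inalgP S y : inalg S y <-> algebraicOver (val : ratT S -> R) y.
Proof.
split=> [[e e0 en0]|[p p0 py]].
  have [p pe] := upoly_lift S e; exists p.
    by apply: contra_neq en0 => p0; rewrite pe p0 rmorph0.
  by rewrite -pe /root horner_upoly e0.
have [d [e [d0 he]]] := upoly_lower p; exists e.
  by rewrite -horner_upoly he hornerZ (eqP py) mulr0.
by rewrite he scaler_eq0 negb_or d0 map_poly_eq0.
Qed.

End RationalValues.

Section AlgebraicClosure.
Variable R : fieldType.
Implicit Types (S : seq R) (e : pexp).

Lemma inalg_mem S y : y \in S -> inalg S y.
Proof.
move=> /(nthP 0)[i iS <-]; exists (PSub (PVar (size S)) (PVar i)).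
  by rewrite /= !nth_rcons ltnn eqxx iS subrr.
rewrite /upoly /= !nth_rcons size_map ltnn eqxx iS (nth_map 0) //.
by rewrite polyXsubC_eq0.
Qed.

Lemma inalg_subset S S' y : {subset S <= S'} -> inalg S y -> inalg S' y.
Proof.
move=> sub [e e0 en0].
(* The last variable goes to the last one, and the variables that read 0 go to one that reads 0. *)
pose f i := if (i < size S)%N then index S`_i S'
            else if i == size S then size S' else (size S').+1.
have hf (A : nzRingType) (g : R -> A) t i : g 0 = 0 ->
    (rcons (map g S') t)`_(f i) = (rcons (map g S) t)`_i.
  move=> g0; rewrite /f !nth_rcons !size_map; case: (ltngtP i (size S)) => iS.
  - have iS' : S`_i \in S' by rewrite sub // mem_nth.
    by rewrite index_mem iS' (nth_map 0) ?index_mem // nth_index // (nth_map 0).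
  - by rewrite ltnNge leqnSn /= gtn_eqF.
  - by rewrite ltnn eqxx.
exists (prename f e).
  rewrite -[RHS]e0; apply: peval_rename => i.
  by have := hf R id y i; rewrite !map_id; apply.
suff -> : upoly S' (prename f e) = upoly S e by [].
by apply: peval_rename => i; apply: hf.
Qed.

Lemma inalg_trans S a y : inalg S a -> inalg (rcons S a) y -> inalg S y.
Proof.
move=> /inalgP Sa [e e0 en0]; apply/inalgP; move: Sa.
apply: algebraic_root_polyXY.
pose Sr := [seq RatT (peval_ratv S (PVar i)) | i <- iota 0 (size S)].
have SrE : map val Sr = S.
  by rewrite -map_comp; apply: (@eq_from_nth _ 0) => [|i]; rewrite size_map size_iota //
    => iS; rewrite (nth_map 0%N) ?size_iota //= nth_iota.
have valC q : (map_poly (map_poly (val : ratT S -> R)) q%:P).[a%:P] = map_poly val q.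
  by rewrite map_polyC hornerC.
(* [e] as a polynomial in two variables over Q(S): the outer indeterminate stands for [a], the inner
   one for [y]. *)
pose p := peval (rcons (rcons (map (polyC \o polyC) Sr) 'X) 'X%:P) e.
have pE : (map_poly (map_poly (val : ratT S -> R)) p).[a%:P] = upoly (rcons S a) e.
  rewrite /p -[LHS]/(horner_eval a%:P _) -!peval_rmorph !map_rcons -!map_comp.
  rewrite /upoly map_rcons; congr (peval (rcons (rcons _ _) _) e).
  - rewrite -[in RHS]SrE -!map_comp; apply: eq_map => r /=.
    by rewrite /horner_eval valC map_polyC.
  - by rewrite -[LHS]/((map_poly (map_poly val) 'X).[a%:P]) map_polyX hornerX.
  - by rewrite -[LHS]/((map_poly (map_poly val) 'X%:P).[a%:P]) valC map_polyX.
exists p; rewrite pE //; apply/rootP.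
by rewrite horner_upoly.
Qed.

Lemma inalg_cat_trans S A y :
  (forall a, a \in A -> inalg S a) -> inalg (S ++ A) y -> inalg S y.
Proof.
elim/last_ind: A y => [|A a IH] y h; first by rewrite cats0.
rewrite -rcons_cat => hy; apply: (IH y).
  by move=> b bA; apply: h; rewrite mem_rcons inE bA orbT.
apply: inalg_trans hy; apply: inalg_subset (h a _); last first.
  by rewrite mem_rcons mem_head.
by move=> b bS; rewrite mem_cat bS.
Qed.

Let swap (n : nat) := prename (fun i => if (i < n)%N then i else
  n + (if (i - n)%N is k.+1 then if k is 0 then 0 else k.+1 else 1))%N.

Let peval_swap (A : nzRingType) (s : seq A) b c e :
  peval (rcons (rcons s b) c) (swap (size s) e) = peval (rcons (rcons s c) b) e.
Proof.
apply: peval_rename => i; rewrite -!cats1 -!catA !nth_cat.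
case: (ltnP i (size s)) => h; first by rewrite h.
by rewrite ltnNge leq_addr /= addKn; case: (i - size s)%N => [|[|k]].
Qed.

(** The same relation with its last two variables swapped works, unless all its coefficients in [a]
    vanish at [y]. As [y] is transcendental over [S], they would then vanish identically, and the
    relation for [y] would be trivial. *)
Lemma inalg_exchange S a y :
  inalg (rcons S a) y -> ~ inalg S y -> inalg (rcons S y) a.
Proof.
move=> [e e0 en0] nSy; pose e' := swap (size S) e.
exists e'; first by rewrite peval_swap.
apply: contra_neq en0 => e'0; pose c := pcoef (size S).+1 e'.
have c0 j : upoly S (c j) = 0.
  apply/eqP/negbNE/negP => cn0; apply: nSy; exists (c j) => //.
  by have := coef_upoly (rcons S y) e' j; rewrite e'0 coef0 size_rcons => <-.
have := peval_swap (map polyC S) a%:P 'X e; rewrite size_map.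
rewrite -/e' /upoly map_rcons.
have <- := peval_swap (map polyC S) 'X a%:P e; rewrite size_map -/e' => _.
rewrite -horner_upoly [upoly _ _](_ : _ = 0) ?horner0 //.
apply/polyP => j; rewrite coef_upoly coef0 size_rcons size_map; exact: c0.
Qed.

End AlgebraicClosure.

(** * Transcendence bases *)

Section TranscendenceBasis.
Variable R : fieldType.
Implicit Types (S T p x y : seq R) (e : pexp).

Lemma inalg_cut S (A : seq R) c : (forall a, a \in A -> inalg S a) -> inalg A c -> inalg S c.
Proof.
move=> h hy; apply: (inalg_cat_trans h); apply: inalg_subset hy => a aA.
by rewrite mem_cat aA orbT.
Qed.

(** Algebraic independence in incremental form, suited to induction; [IndP] identifies it with
    [Ind]. *)
Fixpoint indep S (b : seq R) : Prop :=
  if b is a :: b' then ~ inalg S a /\ indep (rcons S a) b' else True.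

(** Discarded entries also join the base [S]; being algebraic over it, they do not enlarge its
    algebraic closure. The size of the result is the transcendence degree of [x] over Q(S). *)
Fixpoint tbasis S x : seq R :=
  if x is a :: x' then
    if `[< inalg S a >] then tbasis (rcons S a) x' else a :: tbasis (rcons S a) x'
  else [::].

Lemma inalg_rcons S (A : seq R) a :
  (forall c, c \in A -> inalg S c) -> forall c, c \in rcons A a -> inalg (rcons S a) c.
Proof.
move=> h c; rewrite mem_rcons inE => /orP[/eqP->|cA].
  by apply: inalg_mem; rewrite mem_rcons mem_head.
by apply: inalg_subset (h c cA) => d dS; rewrite mem_rcons inE dS orbT.
Qed.

Lemma indep_weaken S A (b : seq R) :
  (forall a, a \in A -> inalg S a) -> indep S b -> indep A b.
Proof.
elim: b S A => //= a b IH S A h [nSa ib]; split.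
  by move=> hA; apply: nSa; apply: inalg_cut hA.
by apply: IH ib; apply: inalg_rcons.
Qed.

Lemma indep_subset S A (b : seq R) : {subset A <= S} -> indep S b -> indep A b.
Proof. by move=> h; apply: indep_weaken => a /h; exact: inalg_mem. Qed.

Lemma indep_rcons S (b : seq R) a : indep S (rcons b a) <-> indep S b /\ ~ inalg (S ++ b) a.
Proof.
elim: b S => [|c b IH] S /=; first by rewrite cats0; tauto.
by rewrite IH cat_rcons; tauto.
Qed.

Lemma indep_tbasis S A x : {subset A <= S} -> indep A (tbasis S x).
Proof.
elim: x S A => //= a x IH S A h.
case: asboolP => aS /=; first by apply: IH => c /h cS; rewrite mem_rcons inE cS orbT.
split; first by move=> hA; apply: aS; apply: inalg_subset hA.
by apply: IH => c; rewrite !mem_rcons !inE => /orP[->//|/h->]; rewrite orbT.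
Qed.

Lemma mem_tbasis S x : {subset tbasis S x <= x}.
Proof.
elim: x S => //= a x IH S c; case: asboolP => _; rewrite !inE; last first.
  by move=> /orP[->//|/IH->]; rewrite orbT.
by move=> /IH->; rewrite orbT.
Qed.

Lemma tbasis_span S x a : a \in x -> inalg (S ++ tbasis S x) a.
Proof.
elim: x S => //= c x IH S; rewrite inE.
case: asboolP => cS.
  move=> /orP[/eqP->|/(IH (rcons S c))].
    by apply: inalg_subset cS => d dS; rewrite mem_cat dS.
  apply: inalg_cut => d; rewrite mem_cat mem_rcons inE -orbA.
  move=> /orP[/eqP->|]; last by rewrite -mem_cat; exact: inalg_mem.
  by apply: inalg_subset cS => d' dS; rewrite mem_cat dS.
move=> /orP[/eqP->|/(IH (rcons S c))]; last by rewrite cat_rcons.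
by apply: inalg_mem; rewrite mem_cat mem_head orbT.
Qed.

(** The entry dropped is the first one that becomes algebraic when [a] is added. By exchange [a] is
    then algebraic over that entry and the base, so the remaining entries stay independent. *)
Lemma indep_drop S a (b : seq R) : indep S b -> ~ indep (rcons S a) b ->
  exists b', [/\ size b = (size b').+1, {subset b' <= b} & indep (rcons S a) b'].
Proof.
elim: b S => [|c b IH] S /= => [_ //|[cS ib] nib].
have [ca|nca] := pselect (inalg (rcons S a) c).
  exists b; split=> //; first by move=> d db; rewrite inE db orbT.
  apply: indep_weaken ib => d; rewrite mem_rcons inE => /orP[/eqP->|dS].
    exact: inalg_exchange.
  by apply: inalg_mem; rewrite mem_rcons inE dS orbT.
have sub (u v : R) : {subset rcons (rcons S u) v <= rcons (rcons S v) u}.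
  by move=> d; rewrite !(mem_rcons, inE) orbCA.
have [|b' [sb bb ib']] := IH _ ib.
  by move=> h; apply: nib; split => //; apply: indep_subset h; exact: sub.
exists (c :: b'); split; rewrite ?sb //=.
  by move=> d; rewrite !inE => /orP[->//|/bb->]; rewrite orbT.
by split=> //; apply: indep_subset ib'; exact: sub.
Qed.

(** Moving an entry of [p] into the base costs at most one entry of [b]. *)
Lemma steinitz S (b : seq R) p :
  indep S b -> (forall a, a \in b -> inalg (S ++ p) a) -> (size b <= size p)%N.
Proof.
elim: p S b => [|a p IH] S b ib h.
  case: b ib h => //= a b [nSa _] h; case: nSa; rewrite -[S]cats0; apply: h.
  exact: mem_head.
have [iab|niab] := pselect (indep (rcons S a) b).
  by apply: leqW; apply: IH iab _ => c /h; rewrite cat_rcons.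
have [b' [-> bb ib']] := indep_drop ib niab.
by apply: IH ib' _ => c /bb /h; rewrite cat_rcons.
Qed.

Lemma size_tbasis S x : (size (tbasis S x) <= size x)%N.
Proof.
elim: x S => //= a x IH S; have := IH (rcons S a).
by case: asboolP => _ //= h; exact: leqW.
Qed.

Lemma indepE S x : indep S x <-> size (tbasis S x) = size x.
Proof.
elim: x S => //= a x IH S; rewrite IH; case: asboolP => aS /=.
  split=> [[]//|h]; by have := size_tbasis (rcons S a) x; rewrite h ltnn.
by split=> [[_ ->]//|[]].
Qed.

(** This amounts to an isomorphism from Q(S) to Q(T) that sends [S] to [T] entry by entry. *)
Definition conjugate S T := size S = size T /\
  forall e, peval S e = 0 <-> peval T e = 0.

Lemma conjugate_inalg S T a b :
  conjugate (rcons S a) (rcons T b) -> inalg S a -> inalg T b.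
Proof.
move=> [sST h] [e /h e0 en0]; exists e => //; apply: contra_neq en0 => eT0.
move: sST; rewrite !size_rcons => -[sST].
apply/polyP => j; rewrite coef_upoly coef0 sST.
have := coef_upoly T e j; rewrite eT0 coef0 => /esym.
rewrite -(peval_lift T b) -(peval_lift S a) sST; exact: (h _).2.
Qed.

Lemma conjugate_sym S T : conjugate S T -> conjugate T S.
Proof. by move=> [sST h]; split=> [|e]; [rewrite sST|rewrite h]. Qed.

Lemma conjugate_catl S T x y : size S = size T ->
  conjugate (S ++ x) (T ++ y) -> conjugate S T.
Proof.
move=> sST [sxy h]; split=> // e.
have {}sxy : size x = size y.
  by apply/eqP; rewrite -(eqn_add2l (size S)) -size_cat sxy size_cat sST.
by rewrite -(peval_trunc S x) -(peval_trunc T y) sST sxy; exact: h.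
Qed.

Lemma conjugate_tbasis S T x y : size S = size T -> 
  conjugate (S ++ x) (T ++ y) -> size (tbasis S x) = size (tbasis T y).
Proof.
elim: x y S T => [|a x IH] [|b y] S T sST //=.
- by move=> [/eqP]; rewrite !size_cat sST eqn_add2l.
- by move=> [/eqP]; rewrite !size_cat sST eqn_add2l.
rewrite -!cat_rcons => hc.
have sab : size (rcons S a) = size (rcons T b) by rewrite !size_rcons sST.
have hab := conjugate_catl sab hc.
have -> : `[< inalg S a >] = `[< inalg T b >].
  apply/asboolP/asboolP; first exact: conjugate_inalg hab.
  exact: conjugate_inalg (conjugate_sym hab).
by have := IH _ _ _ sab hc; case: asboolP => //= _ ->.
Qed.

End TranscendenceBasis.

(** * Independence in terms of multivariate polynomials *)

Section Independence.
Variable R : realType.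
Implicit Types (x z : seq R) (e : pexp).

Lemma rat_adjoinE z r : rat_adjoin z r <-> r \in ratv z.
Proof.
split=> [h|/ratvP[n [d [d0 ->]]] S Sd Sz].
  by apply: h; [exact: ratv_divring_closed|exact: mem_ratv].
have [S1 SB SV] := Sd; have S0 : 0 \in S by rewrite -(subrr 1) SB.
have Se e : peval z e \in S.
  elim: e => //= [i|a IHa b IHb|a IHa b IHb]; last 2 first.
  - exact: SB.
  - rewrite -[peval z b]invrK; apply: (SV) => //; rewrite -[_^-1]mul1r; exact: SV.
  case: (ltnP i (size z)) => h; first by rewrite Sz ?mem_nth.
  by rewrite nth_default.
exact: SV.
Qed.

Lemma poly_nonroot (p : {poly R}) : p != 0 -> exists t, p.[t] != 0.
Proof.
move=> p0; apply: contrapT => /forallNP h.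
have := @max_poly_roots R p [seq k%:R | k <- iota 0 (size p)] p0.
rewrite size_map size_iota ltnn => H; suff: false by [].
apply: H; first by apply/allP => t _; apply/rootP/eqP/negPn/negP; exact: h.
by rewrite map_inj_uniq ?iota_uniq // => i j /eqP; rewrite eqr_nat => /eqP.
Qed.

(** That the relation is not trivial is witnessed by a point [t], a form that carries over to
    [mpoly] by evaluation. *)
Lemma not_indep_vanish z x : ~ indep z x -> exists e t,
  [/\ size t = size x, peval (z ++ x) e = 0 & peval (z ++ t) e != 0].
Proof.
elim/last_ind: x => [[]//|x a IH]; rewrite indep_rcons => h.
have [ix|nix] := pselect (indep z x); last first.
  have [e [t [st e0 en0]]] := IH nix.
  exists (plift (size (z ++ x)) e), (rcons t a).
  by rewrite !size_rcons st -!rcons_cat peval_lift !size_cat -st -size_cat peval_lift.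
have [e e0 /poly_nonroot[t]] : inalg (z ++ x) a.
  by apply: contrapT => na; apply: h.
rewrite horner_upoly => et; exists e, (rcons x t).
by rewrite !size_rcons -!rcons_cat e0 et.
Qed.

(** Over independent entries every relation is trivial, so it holds at any [t]. The values lie in an
    arbitrary ring over R so that [t] may be the indeterminates of [mpoly]. *)
Lemma indep_vanish (A : comNzRingType) (f : {rmorphism R -> A}) z x e (t : seq A) :
  indep z x -> size t = size x -> peval (z ++ x) e = 0 -> peval (map f z ++ t) e = 0.
Proof.
elim/last_ind: x t e => [|x a IH] t e.
  move=> _ /size0nil->; rewrite !cats0 => e0.
  by rewrite peval_rmorph e0 rmorph0.
rewrite indep_rcons => -[ix nxa].
case/lastP: t => [|t b]; rewrite !size_rcons //= => -[st].
rewrite -!rcons_cat => e0.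
have [u0|u0] := eqVneq (upoly (z ++ x) e) 0; last by case: nxa; exists e.
rewrite -horner_upoly [upoly _ _](_ : _ = 0) ?horner0 //.
apply/polyP => j; rewrite coef_upoly coef0; apply: IH => //.
by rewrite size_cat size_map st -size_cat -coef_upoly u0 coef0.
Qed.

Definition mvars z n : seq (mpoly n R) :=
  map (@mpolyC n R) z ++ [seq mpolyX R (mnm1 i) | i <- enum 'I_n].

Lemma meval_mvars z (t : seq R) n e : size t = n ->
  meval (fun i : 'I_n => nth 0 t i) (peval (mvars z n) e) = peval (z ++ t) e.
Proof.
move=> st; rewrite -peval_rmorph; congr (peval _ e).
rewrite map_cat -!map_comp; congr (_ ++ _).
  by rewrite -[RHS]map_id; apply: eq_map => r /=; rewrite mevalC.
rewrite -[RHS](mkseq_nth 0) st /mkseq -val_enum_ord -!map_comp.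
by apply: eq_map => i /=; rewrite mevalXU.
Qed.

Lemma mcoeff_mvars z n e m : mcoeff m (peval (mvars z n) e) \in ratv z.
Proof.
apply/mpolyOverP: m; elim: e => [i||a IHa b IHb|a IHa b IHb] /=; last 2 first.
- exact: rpredB.
- exact: rpredM.
- rewrite nth_cat; case: ltnP => h.
    rewrite (nth_map 0) -?(size_map (@mpolyC n R)) // mpolyOverC mem_ratv //.
    by rewrite mem_nth // -(size_map (@mpolyC n R)).
  case: (ltnP (i - size (map (@mpolyC n R) z)) n) => h2.
    by rewrite (nth_map (Ordinal h2)) ?size_enum_ord // mpolyOverX.
  by rewrite nth_default ?rpred0 // size_map size_enum_ord.
exact: rpred1.
Qed.

(** The multivariate counterpart of [upoly_lower]: monomials and coefficients are assembled while
    their denominators are multiplied up. *)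
Lemma mpoly_lower z n (P : mpoly n R) : (forall m, mcoeff m P \in ratv z) ->
  exists d e, peval z d != 0 /\ peval (mvars z n) e = peval z d *: P.
Proof.
move=> hP; pose Q (p : mpoly n R) := exists d e,
  peval z d != 0 /\ peval (mvars z n) e = peval z d *: p.
have pevalT d : peval (mvars z n) (ptrunc (size z) n d) = @mpolyC n R (peval z d).
  rewrite -[X in ptrunc _ X]card_ord cardE -(size_map (fun i => mpolyX R (mnm1 i))).
  by rewrite -(size_map (@mpolyC n R) z) peval_trunc peval_rmorph.
have QD p q : Q p -> Q q -> Q (p + q).
  move=> [d1 [e1 [h1 E1]]] [d2 [e2 [h2 E2]]].
  exists (PMul d1 d2), (PAdd (PMul (ptrunc (size z) n d2) e1) (PMul (ptrunc (size z) n d1) e2)).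
  rewrite /= mulf_neq0 // subrr sub0r opprK !pevalT E1 E2 !mul_mpolyC scalerDr !scalerA.
  by rewrite [peval z d2 * _]mulrC.
have QM p q : Q p -> Q q -> Q (p * q).
  move=> [d1 [e1 [h1 E1]]] [d2 [e2 [h2 E2]]].
  exists (PMul d1 d2), (PMul e1 e2).
  by rewrite /= mulf_neq0 // E1 E2 -scalerAl -scalerAr scalerA.
have Q1 : Q 1 by exists POne, POne; rewrite /= oner_neq0 scale1r.
have QC c : c \in ratv z -> Q (@mpolyC n R c).
  move=> /ratvP[a [d [d0 ->]]]; exists d, (ptrunc (size z) n a); split=> //.
  by rewrite pevalT -mul_mpolyC -mpolyCM mulrCA divff // mulr1.
have QX i : Q (mpolyX R (mnm1 i)).
  exists POne, (PVar (size z + i)); rewrite /= oner_neq0 scale1r; split=> //.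
  rewrite nth_cat size_map ltnNge leq_addr addKn (nth_map i) ?size_enum_ord //.
  by rewrite nth_ord_enum.
suff [d [e ?]] : Q P by exists d, e.
rewrite [P]mpolyE; apply: big_ind; [|exact: QD|move=> m _].
  by exists POne, PZero; rewrite pevalZero scaler0 /= oner_neq0.
rewrite -mul_mpolyC; apply: (QM); first exact: QC.
rewrite mpolyXE_id; apply: big_ind; [exact: Q1|exact: QM|move=> i _].
by elim: (m i) => [|k IH]; rewrite ?expr0 // exprS; apply: (QM).
Qed.

Lemma IndP z x : Ind z x <-> indep z x.
Proof.
split=> [h|ix P hP P0].
  apply: contrapT => /not_indep_vanish[e [t [st e0 /eqP]]]; apply.
  rewrite -(meval_mvars _ _ st) (h (peval (mvars z (size x)) e)) ?meval0 ?meval_mvars //.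
  by move=> m; apply/rat_adjoinE; exact: mcoeff_mvars.
have [|d [e [d0 he]]] := @mpoly_lower z _ P.
  by move=> m; apply/rat_adjoinE.
have := @indep_vanish _ (@mpolyC (size x) R) z x e
  [seq mpolyX R (mnm1 i) | i <- enum 'I_(size x)] ix.
rewrite size_map size_enum_ord => /(_ erefl).
rewrite -(meval_mvars z e (erefl (size x))) he mevalZ P0 mulr0 => /(_ erefl) /eqP.
by rewrite scaler_eq0 (negPf d0) => /eqP.
Qed.

End Independence.

(** * Isolated zeros *)

Section IsolatedZeros.
Variable R : realType.
Implicit Types (S T x D : seq R) (e : pexp) (eps delta : R).

Definition close delta S T :=
  size T = size S /\ forall i, `|T`_i - S`_i| < delta.

Lemma close_refl delta S : 0 < delta -> close delta S S.
Proof. by move=> d0; split=> // i; rewrite subrr normr0. Qed.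

Lemma close_le delta delta' S T : delta <= delta' -> close delta S T -> close delta' S T.
Proof. by move=> h [sT hT]; split=> // i; exact: lt_le_trans (hT i) h. Qed.

Lemma close_cat delta D S T : 0 < delta -> close delta S T -> close delta (D ++ S) (D ++ T).
Proof.
move=> d0 [sT hT]; rewrite /close !size_cat sT; split=> // i; rewrite !nth_cat.
by case: ifP => _; rewrite ?subrr ?normr0.
Qed.

Lemma close_rcons delta S T a b :
  close delta S T -> `|b - a| < delta -> close delta (rcons S a) (rcons T b).
Proof.
move=> [sT hT] hab; rewrite /close !size_rcons sT; split=> // i; rewrite !nth_rcons sT.
case: ifP => // _; case: ifP => // _; rewrite subrr normr0.
exact: le_lt_trans hab.
Qed.

Lemma peval_cont S e eps : 0 < eps -> exists2 delta, 0 < delta &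
  forall T, close delta S T -> `|peval T e - peval S e| < eps.
Proof.
elim: e eps => [i||a IHa b IHb|a IHa b IHb] eps eps0 /=.
- by exists eps => // T [_].
- by exists 1 => // T _; rewrite subrr normr0.
- have e20 : 0 < eps / 2 by rewrite divr_gt0.
  have [d1 d10 h1] := IHa _ e20; have [d2 d20 h2] := IHb _ e20.
  exists (Num.min d1 d2); first by rewrite lt_min d10.
  move=> T hT.
  have {}h1 : `|peval T a - peval S a| < eps / 2.
    by apply: h1; apply: close_le hT; rewrite ge_min lexx.
  have {}h2 : `|peval T b - peval S b| < eps / 2.
    by apply: h2; apply: close_le hT; rewrite ge_min lexx orbT.
  rewrite (_ : _ - _ = (peval T a - peval S a) - (peval T b - peval S b)); last by ring.
  by apply: le_lt_trans (ler_normB _ _) _; lra.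
- set M := `|peval S a| + `|peval S b| + 1.
  have M0 : 0 < M by rewrite ltr_wpDl // addr_ge0.
  pose eta := Num.min 1 (eps / M).
  have eta0 : 0 < eta by rewrite lt_min ltr01 divr_gt0.
  have [d1 d10 h1] := IHa _ eta0; have [d2 d20 h2] := IHb _ eta0.
  exists (Num.min d1 d2); first by rewrite lt_min d10.
  move=> T hT.
  have {}h1 : `|peval T a - peval S a| < eta.
    by apply: h1; apply: close_le hT; rewrite ge_min lexx.
  have {}h2 : `|peval T b - peval S b| < eta.
    by apply: h2; apply: close_le hT; rewrite ge_min lexx orbT.
  have hb : `|peval T b| <= `|peval S b| + 1.
    have -> : peval T b = peval S b + (peval T b - peval S b) by ring.
    apply: le_trans (ler_normD _ _) _; rewrite lerD2l; apply: ltW.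
    by apply: lt_le_trans h2 _; rewrite ge_min lexx.
  rewrite (_ : _ - _ = (peval T a - peval S a) * peval T b
    + peval S a * (peval T b - peval S b)); last by ring.
  apply: le_lt_trans (ler_normD _ _) _; rewrite !normrM.
  have hM : eta * M <= eps by rewrite -ler_pdivlMr // ge_min lexx orbT.
  apply: lt_le_trans hM; rewrite /M.
  have a0 := normr_ge0 (peval S a); have b0 := normr_ge0 (peval S b).
  have u0 := normr_ge0 (peval T a - peval S a).
  set u := `|_ - _| in h1 u0 *; set v := `|_ - _| in h2 *.
  have h3 : u * `|peval T b| <= u * (`|peval S b| + 1) by rewrite ler_wpM2l.
  nra.
Qed.

Lemma peval_sign S e : peval S e != 0 ->
  exists2 delta, 0 < delta & forall T, close delta S T -> 0 < peval S e * peval T e.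
Proof.
move=> n0; have [|d d0 hd] := @peval_cont S e `|peval S e|; first by rewrite normr_gt0.
exists d => // T /hd; rewrite distrC.
have [h|h] := ltrP 0 (peval S e).
  by rewrite (gtr0_norm h) => /(le_lt_trans (ler_norm _)); nra.
rewrite (ler0_norm h) -normrN opprB => /(le_lt_trans (ler_norm _)) hT.
have : peval S e < 0 by rewrite lt_neqAle n0.
nra.
Qed.

(** A size bound for [upoly S e] uniform in [S], so that one expression can collect the coefficients
    for all valuations. *)
Fixpoint psize e : nat :=
  match e with
  | PVar _ => 2
  | POne => 1
  | PSub a b => maxn (psize a) (psize b)
  | PMul a b => psize a + psize b
  end.

Lemma size_upoly S e : (size (upoly S e) <= psize e)%N.
Proof.
rewrite /upoly; elim: e => [i||a IHa b IHb|a IHa b IHb] /=; last 2 first.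
- rewrite (leq_trans (size_polyD _ _)) // size_polyN geq_max !leq_max IHa IHb.
  by rewrite orbT.
- rewrite (leq_trans (size_polyMleq _ _)) // (leq_trans (leq_pred _)) //.
  exact: leq_add.
- rewrite nth_rcons size_map; case: ltnP => h.
    by rewrite (nth_map 0) // (leq_trans (size_polyC_leq1 _)).
  by case: ifP => _; rewrite ?size_polyX ?size_poly0.
by rewrite size_poly1.
Qed.

(** Over the reals a sum of squares vanishes only if every term does. So the identical vanishing of
    [e] in its last variable is a single equation in the others. *)
Definition pallcoef n e := PSum [seq PMul (pcoef n e j) (pcoef n e j) | j <- iota 0 (psize e)].

Lemma peval_allcoef S e : peval S (pallcoef (size S) e) = 0 <-> upoly S e = 0.
Proof.
rewrite pevalSum big_map; split=> [/eqP|h].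
  rewrite psumr_eq0 => [/allP h|j _]; last by rewrite /= -expr2 sqr_ge0.
  apply/polyP => j; rewrite coef0; case: (ltnP j (psize e)) => hj.
    have /h /= : j \in iota 0 (psize e) by rewrite mem_iota.
    by rewrite mulf_eq0 orbb -coef_upoly => /eqP.
  by rewrite nth_default // (leq_trans (size_upoly S e)).
by apply: big1 => j _ /=; rewrite -!coef_upoly h coef0 mul0r.
Qed.

(** Write [p] as [q * (X - y)]. Then [q] takes the value of the derivative at [y], which is nonzero,
    and so has constant sign nearby. *)
Lemma simple_root_sign_change (p : {poly R}) y delta : 0 < delta ->
  root p y -> p^`().[y] != 0 ->
  exists eta, [/\ 0 < eta, eta < delta & p.[y - eta] * p.[y + eta] < 0].
Proof.
move=> d0 /factor_theorem[q ->]; rewrite derivM derivXsubC mulr1 !hornerE subrr mulr0 add0r.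
move=> qy.
have /nbhs_ballP[e /= e0 he] : \forall t \near y, `|q.[y] - q.[t]| < `|q.[y]|.
  by move/cvgrPdist_lt : (@continuous_horner _ q y); apply; rewrite normr_gt0.
have qS t : `|y - t| < e -> 0 < q.[y] * q.[t].
  move=> /he /=; have [h|h] := ltrP 0 q.[y].
    by rewrite (gtr0_norm h) => /(le_lt_trans (ler_norm _)); nra.
  rewrite (ler0_norm h) -normrN opprB => /(le_lt_trans (ler_norm _)) ht.
  have : q.[y] < 0 by rewrite lt_neqAle qy.
  nra.
pose eta := Num.min delta e / 2.
have m0 : 0 < Num.min delta e by rewrite lt_min d0.
have eta0 : 0 < eta by rewrite divr_gt0.
have etam : eta < Num.min delta e by rewrite /eta; lra.
exists eta; split=> //; first by apply: lt_le_trans etam _; rewrite ge_min lexx.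
have etae : eta < e by apply: lt_le_trans etam _; rewrite ge_min lexx orbT.
have h1 : 0 < q.[y] * q.[y - eta] by apply: qS; rewrite opprB addrC subrK gtr0_norm.
have h2 : 0 < q.[y] * q.[y + eta].
  by apply: qS; rewrite opprD addrA subrr sub0r normrN gtr0_norm.
rewrite !hornerM !hornerXsubC.
have -> : q.[y - eta] * (y - eta - y) * (q.[y + eta] * (y + eta - y)) =
  - (eta * eta * (q.[y - eta] * q.[y + eta])) by ring.
rewrite oppr_lt0 mulr_gt0 ?(mulr_gt0 eta0 eta0) //.
have qq : 0 < q.[y] * q.[y] by rewrite -expr2 exprn_even_gt0.
by rewrite -(pmulr_rgt0 _ qq) mulrACA mulr_gt0.
Qed.

Lemma poly_ivt_opp (p : {poly R}) a b : a <= b -> p.[a] * p.[b] < 0 ->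
  exists2 t, a <= t <= b & root p t.
Proof.
move=> ab; have [pa|pa] := lerP p.[a] 0 => h.
  by apply: poly_ivt => //; rewrite pa /=; nra.
have [||t ht] := @poly_ivt _ (- p) a b; rewrite ?hornerN ?oppr_le0 ?oppr_ge0 //.
  by rewrite (ltW pa) /=; nra.
by rewrite rootN => rt; exists t.
Qed.

(** Take [g] of least degree. Its derivative is nonzero in characteristic 0 and of smaller degree,
    so it cannot vanish at [y]; neither can a nonzero remainder modulo [g]. *)
Lemma minimal_polynomial S y : inalg S y -> exists g : {poly ratT S},
  [/\ root (map_poly val g) y, (map_poly val g)^`().[y] != 0 &
    forall q : {poly ratT S}, root (map_poly val q) y -> g %| q].
Proof.
move=> /inalgP[p p0 py].
have ex : exists n, `[< exists q : {poly ratT S},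
    [/\ q != 0, root (map_poly val q) y & size q = n] >].
  by exists (size p); apply/asboolP; exists p.
have [n /asboolP[g [g0 gy gn]] nmin] := ex_minnP ex.
have {}nmin (q : {poly ratT S}) : q != 0 -> root (map_poly val q) y -> (n <= size q)%N.
  by move=> q0 qy; apply: nmin; apply/asboolP; exists q.
exists g; split=> // [|q qy].
  rewrite deriv_map; apply/negP => gy'.
  have g'0 : g^`() != 0.
    have s1 : (1 < size g)%N.
      rewrite ltnNge; apply/negP => s1; move: gy g0; rewrite (size1_polyC s1).
      by rewrite map_polyC rootC polyC_eq0 => /eqP h /eqP[]; apply: val_inj.
    apply/eqP => /polyP /(_ (size g).-2); rewrite coef0 coef_deriv.
    have -> : (size g).-2.+1 = (size g).-1 by case: (size g) s1 => [|[]].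
    move=> h; have : val (g`_(size g).-1 *+ (size g).-1) == 0 by rewrite h rmorph0.
    rewrite rmorphMn mulrn_eq0; case: eqP => [k0|_ /= /eqP lg]; first by rewrite -subn1 in k0; lia.
    by move: g0; rewrite -lead_coef_eq0 => /eqP[]; apply: val_inj.
  by have := nmin _ g'0 gy'; rewrite leqNgt -gn lt_size_deriv.
apply/modp_eq0P/eqP; apply: contraT => r0.
have ry : root (map_poly val (q %% g)) y.
  move: qy; rewrite {1}(divp_eq q g) rmorphD rmorphM /= /root hornerD hornerM (rootP gy).
  by rewrite mulr0 add0r.
by have := nmin _ r0 ry; rewrite leqNgt -gn ltn_modp g0.
Qed.

(** [E] says that [e] is, up to nonzero factors, a multiple of the minimal polynomial of [y]. For
    [T] near [S] the sign change of that polynomial around [y] persists and gives a root [t]; if [T]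
    satisfies [E], then [e] vanishes there too. *)
Lemma isolated_zero_step S y e : inalg S y -> peval (rcons S y) e = 0 ->
  exists E, peval S E = 0 /\ forall delta, 0 < delta ->
    exists2 eta, 0 < eta & forall T, close eta S T -> peval T E = 0 ->
      exists2 t, `|t - y| < delta & peval (rcons T t) e = 0.
Proof.
move=> /minimal_polynomial[g [gy gy' gmin]] e0.
have [p pE] := upoly_lift S e.
have /gmin/dvdpP[q qE] : root (map_poly val p) y by rewrite -pE /root horner_upoly e0.
have [dg [G [dg0 GE]]] := upoly_lower g; have [dq [Q [dq0 QE]]] := upoly_lower q.
(* The factorisation of [e] with denominators cleared; it is identically 0 in the last variable at
   [S]. *)
pose H := PSub (PMul (PMul (plift (size S) dg) (plift (size S) dq)) e) (PMul G Q).
have HE T t : size T = size S -> peval (rcons T t) H =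
    peval T dg * peval T dq * peval (rcons T t) e - peval (rcons T t) G * peval (rcons T t) Q.
  by move=> sT; rewrite /H /= -sT !peval_lift.
have H0 : upoly S H = 0.
  rewrite /H /upoly /= -/(upoly S e) -/(upoly S G) -/(upoly S Q).
  have lift d : peval (rcons (map polyC S) 'X) (plift (size S) d) = (peval S d)%:P.
    by rewrite -(size_map polyC) peval_lift peval_rmorph.
  rewrite !lift GE QE pE qE rmorphM /= -!mul_polyC; ring.
exists (pallcoef (size S) H); split; first exact/peval_allcoef.
move=> delta d0.
have Gy : root (upoly S G) y by rewrite GE /root hornerZ (rootP gy) mulr0.
have Gy' : (upoly S G)^`().[y] != 0 by rewrite GE derivZ hornerZ mulf_neq0.
have [eta [eta0 etad hG]] := simple_root_sign_change d0 Gy Gy'.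
rewrite !horner_upoly in hG.
have [|d1 d10 h1] := @peval_sign (rcons S (y - eta)) G.
  by apply/eqP => h; rewrite h mul0r ltxx in hG.
have [|d2 d20 h2] := @peval_sign (rcons S (y + eta)) G.
  by apply/eqP => h; rewrite h mulr0 ltxx in hG.
have [d3 d30 h3] := peval_sign dg0; have [d4 d40 h4] := peval_sign dq0.
pose m := Num.min (Num.min d1 d2) (Num.min d3 d4).
have m0 : 0 < m by rewrite !lt_min d10 d20 d30 d40.
have [m1 m2 m3 m4] : [/\ m <= d1, m <= d2, m <= d3 & m <= d4].
  by rewrite /m; split; rewrite !ge_min lexx ?orbT.
exists m => // T hT ET.
have sT : size T = size S by case: hT.
have HT : upoly T H = 0 by apply/peval_allcoef; rewrite sT.
have {}h1 : 0 < peval (rcons S (y - eta)) G * peval (rcons T (y - eta)) G.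
  by apply/h1/close_rcons; [apply: close_le hT | rewrite subrr normr0].
have {}h2 : 0 < peval (rcons S (y + eta)) G * peval (rcons T (y + eta)) G.
  by apply/h2/close_rcons; [apply: close_le hT | rewrite subrr normr0].
have {}h3 : peval T dg != 0.
  by have := h3 _ (close_le m3 hT); case: eqP => // ->; rewrite mulr0 ltxx.
have {}h4 : peval T dq != 0.
  by have := h4 _ (close_le m4 hT); case: eqP => // ->; rewrite mulr0 ltxx.
have [||t ht /rootP] := @poly_ivt_opp (upoly T G) (y - eta) (y + eta).
- by rewrite lerD2l ge0_cp // ltW.
- rewrite !horner_upoly.
  have := mulr_gt0 h1 h2; rewrite mulrACA (nmulr_rgt0 _ hG); exact.
rewrite horner_upoly => Gt; exists t.
  by apply: le_lt_trans etad; rewrite ler_norml; lra.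
have := horner_upoly T H t; rewrite HT horner0 HE // Gt mul0r subr0 => /esym/eqP.
by rewrite !mulf_eq0 (negPf h3) (negPf h4) => /eqP.
Qed.

(* The last coordinate that is not algebraic over the previous ones can be moved freely,
   and the later ones follow it as simple roots of their minimal polynomials. *)
Lemma zero_not_isolated D x e delta :
  ~ (forall a, a \in x -> inalg D a) -> peval (D ++ x) e = 0 -> 0 < delta ->
  exists x', [/\ x' <> x, close delta x x' & peval (D ++ x') e = 0].
Proof.
elim/last_ind: x e delta => [|x y IH] e delta nalg e0 d0; first by case: nalg.
rewrite -rcons_cat in e0.
have [ay|nay] := pselect (inalg (D ++ x) y); last first.
  exists (rcons x (y + delta / 2)); split.
  - by move=> /rcons_inj[] /eqP; rewrite -subr_eq0 addrC addKr gt_eqF ?divr_gt0.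
  - apply: close_rcons; first exact: close_refl.
    by rewrite addrC addKr gtr0_norm ?divr_gt0 //; lra.
  rewrite -rcons_cat -horner_upoly.
  by have [->|u0] := eqVneq (upoly (D ++ x) e) 0; [rewrite horner0|case: nay; exists e].
have nx : ~ (forall a, a \in x -> inalg D a).
  move=> h; apply: nalg => a; rewrite mem_rcons inE => /orP[/eqP->|/h//].
  exact: inalg_cat_trans ay.
have [E [E0 /(_ _ d0)[eta eta0 hE]]] := isolated_zero_step ay e0.
have m0 : 0 < Num.min eta delta by rewrite lt_min eta0.
have [x' [x'x hx' Ex']] := IH E _ nx E0 m0.
have [|t ty et] := hE (D ++ x') _ Ex'.
  by apply: close_cat => //; apply: close_le hx'; rewrite ge_min lexx.
exists (rcons x' t); split; first by move=> /rcons_inj[].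
  by apply: close_rcons ty; apply: close_le hx'; rewrite ge_min lexx orbT.
by rewrite -rcons_cat.
Qed.

End IsolatedZeros.

(** * Runs near a point *)

Section Germs.
Variable R : realType.
Variables (D x : seq R) (W : set (seq R)).
Hypothesis Wx : W x.
Implicit Types (Q : seq R -> Prop) (f g : seq R -> R) (e : pexp).

(* A run on [x] performs finitely many tests. The equation keeps those that compare equal
   values on [x], and [eta] keeps the strict inequalities; [W] is needed for oracles only. *)
Definition near Q := exists e eta, [/\ 0 < eta, peval (D ++ x) e = 0 &
  forall w, W w -> close eta x w -> peval (D ++ w) e = 0 -> Q w].

Lemma near_mono Q Q' : (forall w, W w -> Q w -> Q' w) -> near Q -> near Q'.
Proof. by move=> h [e [eta [e0 ex hQ]]]; exists e, eta; split=> // w Ww *; apply/h/hQ. Qed.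

Lemma near_true Q : (forall w, W w -> Q w) -> near Q.
Proof.
move=> h; exists PZero, 1; split; rewrite ?pevalZero //.
by move=> w /h.
Qed.

Lemma near_self Q : near Q -> Q x.
Proof. by move=> [e [eta [e0 ex hQ]]]; apply: hQ => //; exact: close_refl. Qed.

(** The two equations are merged into one as a sum of squares. *)
Lemma near_and Q Q' : near Q -> near Q' -> near (fun w => Q w /\ Q' w).
Proof.
move=> [e [eta [e0 ex hQ]]] [e' [eta' [e0' ex' hQ']]].
exists (PAdd (PMul e e) (PMul e' e')), (Num.min eta eta'); split.
- by rewrite lt_min e0.
- by rewrite pevalAdd /= ex ex' mulr0 addr0.
move=> w Ww cw /eqP; rewrite pevalAdd /= -!expr2 paddr_eq0 ?sqr_ge0 // !sqrf_eq0.
move=> /andP[/eqP ew /eqP ew']; split.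
  by apply: hQ => //; apply: close_le cw; rewrite ge_min lexx.
by apply: hQ' => //; apply: close_le cw; rewrite ge_min lexx orbT.
Qed.

Lemma near_mp Q Q' : near Q -> near (fun w => Q w -> Q' w) -> near Q'.
Proof.
by move=> h1 h2; apply: near_mono (near_and h1 h2) => w _ [q]; apply.
Qed.

Lemma near_eq0 e : peval (D ++ x) e = 0 -> near (fun w => peval (D ++ w) e = 0).
Proof. by move=> ex; exists e, 1; split. Qed.

Lemma near_sign e : peval (D ++ x) e != 0 ->
  near (fun w => 0 < peval (D ++ x) e * peval (D ++ w) e).
Proof.
move=> /peval_sign[eta e0 he]; exists PZero, eta; rewrite pevalZero; split=> //.
by move=> w _ cw _; apply/he/close_cat.
Qed.

Lemma near_neq0 e : peval (D ++ x) e != 0 -> near (fun w => peval (D ++ w) e != 0).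
Proof.
move=> /near_sign; apply: near_mono => w _; apply: contraTneq => ->.
by rewrite mulr0 ltxx.
Qed.

(* Locally a rational function over [Q(D)]. *)
Definition good f := exists n d, peval (D ++ x) d != 0 /\
  near (fun w => f w = peval (D ++ w) n / peval (D ++ w) d).

Lemma good_near f g : near (fun w => f w = g w) -> good f -> good g.
Proof.
move=> fg [n [d [d0 h]]]; exists n, d; split=> //.
by apply: (near_mp h); apply: near_mono fg => w _ ->.
Qed.

Lemma good_peval e : good (fun w => peval (D ++ w) e).
Proof.
exists e, POne; rewrite oner_neq0; split=> //.
by apply: near_true => w _; rewrite divr1.
Qed.

Lemma good_var i : good (fun w => w`_i).
Proof.
apply: good_near (good_peval (PVar (size D + i))).
by apply: near_true => w _; rewrite /= nth_cat ltnNge leq_addr addKn.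
Qed.

Lemma good_nat n : good (fun=> n%:R).
Proof.
by apply: good_near (good_peval (pnat n)); apply: near_true => w _; rewrite peval_nat.
Qed.

Lemma good_mem c : c \in D -> good (fun=> c).
Proof.
move=> cD; apply: good_near (good_peval (PVar (index c D))).
by apply: near_true => w _; rewrite /= nth_cat index_mem cD nth_index.
Qed.

Lemma good_nth (l : seq R) i : {subset l <= D} -> good (fun=> l`_i).
Proof.
move=> lD; case: (ltnP i (size l)) => h; first by apply/good_mem/lD/mem_nth.
by rewrite nth_default //; exact: (good_nat 0).
Qed.

Lemma good_sub f g : good f -> good g -> good (fun w => f w - g w).
Proof.
move=> [n [d [d0 h]]] [n' [d' [d0' h']]].
exists (PSub (PMul n d') (PMul n' d)), (PMul d d'); split; first by rewrite /= mulf_neq0.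
apply: (near_mp (near_and (near_neq0 d0) (near_neq0 d0'))).
apply: near_mono (near_and h h') => w _ [-> ->] [h1 h2] /=.
by rewrite -mulNr addf_div // mulNr.
Qed.

Lemma good_mul f g : good f -> good g -> good (fun w => f w * g w).
Proof.
move=> [n [d [d0 h]]] [n' [d' [d0' h']]].
exists (PMul n n'), (PMul d d'); split; first by rewrite /= mulf_neq0.
by apply: near_mono (near_and h h') => w _ [-> ->] /=; rewrite mulf_div.
Qed.

Lemma good_add f g : good f -> good g -> good (fun w => f w + g w).
Proof.
move=> gf gg; apply: good_near (good_sub gf (good_sub (good_nat 0) gg)).
by apply: near_true => w _; rewrite sub0r opprK.
Qed.

Lemma good_div f g : g x != 0 -> good f -> good g -> good (fun w => f w / g w).
Proof.
move=> gx [n [d [d0 h]]] [n' [d' [d0' h']]].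
have n0' : peval (D ++ x) n' != 0.
  by apply: contra_neq gx => h0; rewrite (near_self h') h0 mul0r.
exists (PMul n d'), (PMul d n'); split; first by rewrite /= mulf_neq0.
by apply: near_mono (near_and h h') => w _ [-> ->] /=; rewrite invf_div mulf_div.
Qed.

Lemma good_eq0 f : good f -> f x = 0 -> near (fun w => f w = 0).
Proof.
move=> [n [d [d0 h]]] fx.
have n0 : peval (D ++ x) n = 0.
  move/near_self: h; rewrite fx => /esym/eqP.
  by rewrite mulf_eq0 invr_eq0 (negPf d0) orbF => /eqP.
by apply: near_mono (near_and h (near_eq0 n0)) => w _ [-> ->]; rewrite mul0r.
Qed.

Lemma good_neq0 f : good f -> f x != 0 -> near (fun w => 0 < f x * f w).
Proof.
move=> [n [d [d0 h]]] fx.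
have n0 : peval (D ++ x) n != 0.
  by apply: contra_neq fx => h0; rewrite (near_self h) h0 mul0r.
apply: near_mono (near_and h (near_and (near_sign n0) (near_sign d0))).
move=> w _ [-> [hn hd]]; rewrite (near_self h) mulf_div.
by rewrite divr_gt0.
Qed.

Lemma good_lt f g : good f -> good g -> near (fun w => (f w < g w) = (f x < g x)).
Proof.
move=> gf gg; have gfg := good_sub gf gg.
have [fx|fx] := eqVneq (f x - g x) 0.
  apply: near_mono (good_eq0 gfg fx) => w _ /eqP; rewrite subr_eq0 => /eqP ->.
  by move/eqP: fx; rewrite subr_eq0 => /eqP ->; rewrite !ltxx.
apply: near_mono (good_neq0 gfg fx) => w _ h.
by rewrite -subr_lt0 -[RHS]subr_lt0; apply/idP/idP; move: h; nra.
Qed.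

Definition good_vector (F : seq R -> seq R) :=
  near (fun w => size (F w) = size (F x)) /\ forall k, good (fun w => (F w)`_k).

Definition good_state (s : seq R -> config R) :=
  [/\ near (fun w => pc (s w) = pc (s x) /\ idx (s w) = idx (s x)),
      forall k, good (fun w => reg (s w) k) & forall k, good (fun w => Defs.mem (s w) k)].

Lemma good_state_near s s' :
  near (fun w => s w = s' w) -> good_state s -> good_state s'.
Proof.
move=> ss' [h1 h2 h3]; split.
- by apply: near_mono (near_and ss' h1) => w _ []; rewrite (near_self ss') => ->.
- by move=> k; apply: good_near (h2 k); apply: near_mono ss' => w _ ->.
- by move=> k; apply: good_near (h3 k); apply: near_mono ss' => w _ ->.
Qed.

Lemma good_update (r : seq R -> nat -> R) d v :
  good v -> (forall k, good (fun w => r w k)) ->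
  forall k, good (fun w => [eta r w with d |-> v w] k).
Proof. by move=> gv gr k /=; case: (k == d). Qed.

Variables (O : oracle R) (P : ocontrol) (own host : seq R).
Hypothesis own_D : {subset own <= D}.
Hypothesis host_D : {subset host <= D}.
(** An answer may influence addresses through its size, so it has to be locally constant; its
    entries enter the memory, so they have to be good. *)
Hypothesis good_oracle : forall F, good_vector F ->
  near (fun w => O (F w) = O (F x)) /\
  (forall v, O (F x) = Some v -> forall k, good (fun=> v`_k)).

Lemma good_segment (m : seq R -> nat -> R) i j :
  (forall k, good (fun w => m w k)) -> good_vector (fun w => segment (m w) i j).
Proof.
move=> gm; split; first by apply: near_true => w _; rewrite !size_map.
move=> k; case: (ltnP k (size (index_iota i j))) => h.
  apply: good_near (gm (nth 0 (index_iota i j) k)).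
  by apply: near_true => w _; rewrite (nth_map 0%N).
apply: good_near (good_nat 0).
by apply: near_true => w _; rewrite nth_default ?size_map.
Qed.

Lemma good_step s : good_state s -> good_state (fun w => step O P own host (s w)).
Proof.
move=> gs; have [h1 h2 h3] := gs.
set p := pc (s x) in h1; set ix := idx (s x) in h1.
have sE : near (fun w => s w = Config p (reg (s w)) ix (Defs.mem (s w))).
  by apply: near_mono h1 => w _; case: (s w) => ? ? ? ? /= [-> ->].
have stE c : onth P p = Some c ->
    near (fun w => step_oinstr O own host c (Config p (reg (s w)) ix (Defs.mem (s w)))
      = step O P own host (s w)).
  by move=> e; apply: near_mono sE => w _ ->; rewrite /step /= e.
(* The case of a state that repeats itself: program ended, result undefined or query unanswered. *)
have stay s' : near (fun w => Config p (reg (s w)) ix (Defs.mem (s w)) = s' w) -> good_state s'.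
  move=> h; apply: good_state_near gs; apply: (near_mp h).
  by apply: near_mono sE => w _ ->.
have mk q r ix' m : (forall k, good (fun w => r w k)) -> (forall k, good (fun w => m w k)) ->
    good_state (fun w => Config q (r w) ix' (m w)).
  by move=> gr gm; split => //; exact: near_true.
case e : (onth P p) => [c|]; last first.
  by apply: stay; apply: near_mono sE => w _ ->; rewrite /step /= e.
have {}stE := stE _ e; case: c e stE => [c|i j] e /=; last first.
  have [hO hv] := good_oracle (good_segment (ix i) (ix j) h3).
  case Oe : (O (segment (Defs.mem (s x)) (ix i) (ix j))) => [v|] in hO hv.
    move=> stE; apply: good_state_near (mk p.+1 (fun w => reg (s w))
      [eta ix with j |-> (ix i + size v)%N]
      (fun w => overwrite (Defs.mem (s w)) (ix i) v) h2 _).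
      by have := near_and stE hO; apply: near_mono => w _ [<- ->].
    move=> k; rewrite /overwrite; case: (_ && _) => //; exact: hv.
  by move=> stE; apply: stay; have := near_and stE hO; apply: near_mono => w _ [<- ->].
case: c e => [op d a b|d c|d i|i a|i j|i|i|a b l|i j l] e /= stE;
  try by apply: good_state_near stE _; apply: mk => //; apply: good_update.
(* The result of the operation, read as 0 where the division is undefined; whether it is defined is
   locally constant. *)
- have gab : good (fun w => if arith_val op (reg (s w) a) (reg (s w) b) is Some v then v else 0)
    /\ near (fun w => isSome (arith_val op (reg (s w) a) (reg (s w) b))
                    = isSome (arith_val op (reg (s x) a) (reg (s x) b))).
    case: op e stE => e stE /=.
    - by split; [exact: good_add|exact: near_true].
    - by split; [exact: good_sub|exact: near_true].
    - by split; [exact: good_mul|exact: near_true].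
    - have [bx|bx] := eqVneq (reg (s x) b) 0.
        have bw := good_eq0 (h2 b) bx; split.
          by apply: good_near (good_nat 0); apply: near_mono bw => w _ ->; rewrite eqxx.
        by apply: near_mono bw => w _ ->; rewrite eqxx.
      have bw : near (fun w => reg (s w) b != 0).
        apply: near_mono (good_neq0 (h2 b) bx) => w _; apply: contraTneq => ->.
        by rewrite mulr0 ltxx.
      split; last by apply: near_mono bw => w _ /negPf ->.
      apply: good_near (good_div bx (h2 a) (h2 b)).
      by apply: near_mono bw => w _ /negPf ->.
  case: gab => gab; case: (arith_val op (reg (s x) a) (reg (s x) b)) => [v|] /= hs.
    apply: good_state_near (mk p.+1 _ ix _ (@good_update _ d _ gab h2) h3).
    apply: near_mono (near_and stE hs) => w _ [<-].
    by case: (arith_val _ _ _).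
  apply: stay; apply: near_mono (near_and stE hs) => w _ [<-].
  by case: (arith_val _ _ _).
- apply: good_state_near stE _; apply: mk => //; apply: good_update => //.
  by case: c e => [|k|k] e /=; [exact: (good_nat 1)|exact: good_nth|exact: good_nth].
- apply: good_state_near (mk (if reg (s x) a < reg (s x) b then l else p.+1) _ ix _ h2 h3).
  apply: near_mono (near_and stE (good_lt (h2 a) (h2 b))) => w _ [<- ->].
  by [].
Qed.

Lemma good_run F t : good_vector F -> good_state (fun w => run O P own host (F w) t).
Proof.
move=> [hs gF]; elim: t => [|t IH]; last exact: good_step.
split => //=; first by apply: near_mono hs => w _ ->.
by move=> k; exact: (good_nat 0).
Qed.

Lemma halts_in_near F : good_vector F -> halts_in O P own host (F x) ->
  near (fun w => halts_in O P own host (F w)).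
Proof.
move=> gF [t ht]; have [h _ _] := good_run t gF.
by apply: near_mono h => w _ [hp _]; exists t; rewrite hp.
Qed.

Lemma returns_in_near F y : good_vector F -> returns_in O P own host (F x) y ->
  exists G, [/\ good_vector G, G x = y & near (fun w => returns_in O P own host (F w) (G w))].
Proof.
move=> gF [t ht <-]; have [h _ gm] := good_run t gF.
exists (fun w => segment (Defs.mem (run O P own host (F w) t)) 0
  (idx (run O P own host (F x) t) 0)).
split=> //; first exact: good_segment.
by apply: near_mono h => w _ [hp hi]; exists t; rewrite ?hp // /output hi.
Qed.

End Germs.

(** * Structured programs *)

Inductive test := TLt of nat & nat | TIdx of nat & nat.

Inductive stmt :=
| Do of oinstr
| Skip
| Seq of stmt & stmt
| If of test & stmt & stmt
| While of test & stmt.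

Definition jump (t : test) (l : nat) : oinstr :=
  match t with
  | TLt a b => Plain (JumpLt a b l)
  | TIdx i j => Plain (JumpIdxLe i j l)
  end.

Definition goto (l : nat) : oinstr := Plain (JumpIdxLe 0 0 l).

Fixpoint csize (s : stmt) : nat :=
  match s with
  | Do _ => 1
  | Skip => 0
  | Seq a b => csize a + csize b
  | If _ a b => (csize b + csize a).+2
  | While _ a => (csize a).+3
  end.

(* [o] is the address of the first instruction. *)
Fixpoint compile (o : nat) (s : stmt) : ocontrol :=
  match s with
  | Do c => [:: c]
  | Skip => [::]
  | Seq a b => compile o a ++ compile (o + csize a) b
  | If t a b => jump t (o + csize b).+2 ::
      compile o.+1 b ++ goto ((o + csize b).+2 + csize a) :: compile (o + csize b).+2 a
  | While t a => jump t o.+2 :: goto (o + csize a).+3 :: compile o.+2 a ++ [:: goto o]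
  end.

Lemma size_compile o s : size (compile o s) = csize s.
Proof.
elim: s o => //= [a IHa b IHb|t a IHa b IHb|t a IHa] o.
- by rewrite size_cat IHa IHb.
- by rewrite size_cat /= IHa IHb addnS.
- by rewrite size_cat /= IHa addn1.
Qed.

(** * Weakest preconditions *)

Section Wp.
Variable R : realType.
Variables (O : oracle R) (own host : seq R).

Definition post := (nat -> R) -> (nat -> nat) -> (nat -> R) -> Prop.
Implicit Types (Q : post) (r m : nat -> R) (ix : nat -> nat).

Definition holds_test (t : test) r ix : bool :=
  match t with TLt a b => r a < r b | TIdx i j => (ix i <= ix j)%N end.

(** Undefined results get [False], since the machine would loop on them; raw jumps do as well,
    because control flow is left to [If] and [While]. *)
Definition wp_do (c : oinstr) Q : post := fun r ix m =>
  match c with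
  | Plain (Arith op d a b) =>
      if arith_val op (r a) (r b) is Some v then Q [eta r with d |-> v] ix m else False
  | Plain (Const d c) => Q [eta r with d |-> const_val own host c] ix m
  | Plain (Fetch d i) => Q [eta r with d |-> m (ix i)] ix m
  | Plain (Store i a) => Q r ix [eta m with ix i |-> r a]
  | Plain (IdxCopy i j) => Q r [eta ix with i |-> ix j] m
  | Plain (IdxInc i) => Q r [eta ix with i |-> (ix i).+1] m
  | Plain (IdxDec i) => Q r [eta ix with i |-> (ix i).-1] m
  | Plain (JumpLt _ _ _) | Plain (JumpIdxLe _ _ _) => False
  | Query i j =>
      if O (segment m (ix i) (ix j)) is Some v
      then Q r [eta ix with j |-> (ix i + size v)%N] (overwrite m (ix i) v) else False
  end.

(** [n] bounds the number of iterations, so that the existential quantifier in [wp] expresses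
    termination. *)
Fixpoint wp_loop (B : post -> post) t Q n : post := fun r ix m =>
  if n is n'.+1 then
    if holds_test t r ix then B (wp_loop B t Q n') r ix m else Q r ix m
  else ~~ holds_test t r ix /\ Q r ix m.

(* Total correctness: [s] terminates in a state satisfying [Q]. *)
Fixpoint wp (s : stmt) Q : post :=
  match s with
  | Do c => wp_do c Q
  | Skip => Q
  | Seq a b => wp a (wp b Q)
  | If t a b => fun r ix m => if holds_test t r ix then wp a Q r ix m else wp b Q r ix m
  | While t a => fun r ix m => exists n, wp_loop (wp a) t Q n r ix m
  end.

Lemma wp_mono s Q Q' r ix m :
  (forall r ix m, Q r ix m -> Q' r ix m) -> wp s Q r ix m -> wp s Q' r ix m.
Proof.
elim: s Q Q' r ix m => [c||a IHa b IHb|t a IHa b IHb|t a IHa] Q Q' r ix m h /=.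
- case: c => [[op d a b|d c|d i|i a|i j|i|i|a b l|i j l]|i j] //=; try exact: h.
    by case: arith_val => // v; exact: h.
  by case: (O _) => // v; exact: h.
- exact: h.
- by apply: IHa => *; apply: IHb; eauto.
- by case: ifP => _; [exact: IHa|exact: IHb].
- move=> [n hn]; exists n; elim: n r ix m hn => [|n IH] r ix m /=.
    by move=> [-> /h].
  by case: ifP => _; [apply: IHa; exact: IH|exact: h].
Qed.

(** The index of the invariant is the number of iterations left. *)
Lemma wp_while t a (I : nat -> post) Q n r ix m :
  (forall r ix m, I 0%N r ix m -> ~~ holds_test t r ix /\ Q r ix m) ->
  (forall n r ix m, I n.+1 r ix m -> holds_test t r ix /\ wp a (I n) r ix m) ->
  I n r ix m -> wp (While t a) Q r ix m.
Proof.
move=> h0 hS hI; exists n; elim: n r ix m hI => [|n IH] r ix m //=; first exact: h0.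
by move=> /hS[-> h]; apply: wp_mono h; exact: IH.
Qed.

Local Arguments onth : simpl never.

Fixpoint placed (P : ocontrol) (o : nat) (C : ocontrol) : Prop :=
  if C is c :: C' then onth P o = Some c /\ placed P o.+1 C' else True.

Lemma placed_cat P o C C' :
  placed P o (C ++ C') <-> placed P o C /\ placed P (o + size C) C'.
Proof.
elim: C o => [|c C IH] o /=; first by rewrite addn0; tauto.
by rewrite IH addSnnS; tauto.
Qed.

Lemma placed_self P pre : placed (pre ++ P) (size pre) P.
Proof.
elim: P pre => //= c P IH pre; rewrite onth_cat ltnn subnn; split=> //.
by rewrite -cat_rcons -(size_rcons pre c); exact: IH.
Qed.

Lemma wp_sound P o s Q r ix m : placed P o (compile o s) -> wp s Q r ix m ->
  exists t r' ix' m', Q r' ix' m' /\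
  iter t (step O P own host) (Config o r ix m) = Config (o + csize s) r' ix' m'.
Proof.
have jumpE p r0 ix0 m0 t l : onth P p = Some (jump t l) ->
    step O P own host (Config p r0 ix0 m0)
      = Config (if holds_test t r0 ix0 then l else p.+1) r0 ix0 m0.
  by move=> e; rewrite /step /= e; case: t {e}.
have gotoE p r0 ix0 m0 l : onth P p = Some (goto l) ->
    step O P own host (Config p r0 ix0 m0) = Config l r0 ix0 m0.
  by move=> e; rewrite /step /= e /= leqnn.
elim: s o Q r ix m => [c||a IHa b IHb|t a IHa b IHb|t a IHa] o Q r ix m /=.
- move=> [e _] h; exists 1%N; rewrite /= /step /= e addn1.
  case: c h {e} => [[op d a b|d c|d i|i a|i j|i|i|a b l|i j l]|i j] //=;
    try by move=> h; do 3!eexists; split; first exact: h.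
    by case: arith_val => // v h; do 3!eexists; split; first exact: h.
  by case: (O _) => // v h; do 3!eexists; split; first exact: h.
- by move=> _ h; exists 0%N, r, ix, m; rewrite addn0.
- rewrite placed_cat size_compile => -[ha hb] /(IHa _ _ _ _ _ ha).
  move=> [t1 [r1 [ix1 [m1 [h1 e1]]]]].
  have [t2 [r2 [ix2 [m2 [h2 e2]]]]] := IHb _ _ _ _ _ hb h1.
  by exists (t2 + t1)%N, r2, ix2, m2; rewrite iterD e1 e2 addnA.
- rewrite placed_cat size_compile /= => -[ht [hb []]].
  rewrite addSn => hg ha; case: ifP => tst.
    move=> /(IHa _ _ _ _ _ ha) [t1 [r1 [ix1 [m1 [h1 e1]]]]].
    exists t1.+1, r1, ix1, m1; split=> //.
    by rewrite iterSr (jumpE _ _ _ _ _ _ ht) tst e1 !addnS addnA.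
  move=> /(IHb _ _ _ _ _ hb) [t1 [r1 [ix1 [m1 [h1 e1]]]]].
  exists t1.+2, r1, ix1, m1; split=> //.
  rewrite iterSr (jumpE _ _ _ _ _ _ ht) tst iterS e1 (gotoE _ _ _ _ _ hg).
  by rewrite !addnS addnA.
rewrite placed_cat size_compile /= => -[ht [hx [ha [hg _]]]] [n hn].
elim: n r ix m hn => [|n IH] r ix m /=.
  move=> [tst hQ]; exists 2%N, r, ix, m; split => //=.
  by rewrite (jumpE _ _ _ _ _ _ ht) (negPf tst) (gotoE _ _ _ _ _ hx) !addnS.
case: ifP => tst hn; last first.
  exists 2%N, r, ix, m; split => //=.
  by rewrite (jumpE _ _ _ _ _ _ ht) tst (gotoE _ _ _ _ _ hx) !addnS.
have [t1 [r1 [ix1 [m1 [h1 e1]]]]] := IHa _ _ _ _ _ ha hn.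
have [t2 [r2 [ix2 [m2 [h2 e2]]]]] := IH _ _ _ h1.
exists (t2 + t1.+2)%N, r2, ix2, m2; split=> //.
rewrite iterD iterS iterSr (jumpE _ _ _ _ _ _ ht) tst e1.
by rewrite (gotoE _ _ _ _ _ hg) e2.
Qed.

Lemma returns_wp s x y :
  wp s (fun _ ix m => segment m 0 (ix 0%N) = y)
    (fun=> 0) [eta (fun=> 0%N) with 0%N |-> size x] (nth 0 x) ->
  returns_in O (compile 0 s) own host x y.
Proof.
have hp : placed (compile 0 s) 0 (compile 0 s) := placed_self _ [::].
move=> /(wp_sound hp) [t [r [ix [m [hy e]]]]]; exists t.
  by rewrite [run _ _ _ _ _ _]e size_compile.
by rewrite [run _ _ _ _ _ _]e.
Qed.

End Wp.

Fixpoint plain (s : stmt) : bool :=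
  match s with
  | Do (Query _ _) => false
  | Seq a b | If _ a b => plain a && plain b
  | While _ a => plain a
  | _ => true
  end.

Definition strip (c : oinstr) : instr := if c is Plain i then i else IdxInc 0.

Lemma compile_plain o s : plain s -> map Plain (map strip (compile o s)) = compile o s.
Proof.
elim: s o => [[]||a IHa b IHb|t a IHa b IHb|t a IHa] o //=.
- by move=> /andP[ha hb]; rewrite !map_cat IHa ?IHb.
- by move=> /andP[ha hb]; rewrite !map_cat /= IHa ?IHb //; case: t.
- by move=> ha; rewrite !map_cat /= IHa //; case: t.
Qed.

(** * Deciding a singleton *)

Notation arithi op d a b := (Do (Plain (Arith op d a b))).
Notation consti d c := (Do (Plain (Const d c))).
Notation fetchi d i := (Do (Plain (Fetch d i))).
Notation storei i a := (Do (Plain (Store i a))).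
Notation copyi i j := (Do (Plain (IdxCopy i j))).
Notation inci i := (Do (Plain (IdxInc i))).
Notation deci i := (Do (Plain (IdxDec i))).

Definition seqs (l : seq stmt) : stmt := foldr Seq Skip l.

Definition incs (i n : nat) : stmt := iter n (Seq (inci i)) Skip.

(* Evaluates a polynomial in the host constants, the own constants and the
   memory cells into register [d], using the registers above [d] and the index
   registers 2 and 9 (the latter holding 0). *)
Fixpoint cexp (h o d : nat) (e : pexp) : stmt :=
  match e with
  | PVar i =>
      if (i < h)%N then consti d (Host i)
      else if (i < h + o)%N then consti d (Own (i - h))
      else seqs [:: copyi 2 9; incs 2 (i - (h + o)); fetchi d 2]
  | POne => consti d One
  | PSub a b => seqs [:: cexp h o d a; cexp h o d.+1 b; arithi Defs.Sub d d d.+1]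
  | PMul a b => seqs [:: cexp h o d a; cexp h o d.+1 b; arithi Defs.Mul d d d.+1]
  end.

Definition clear0 := arithi Defs.Sub 0 1 1.

(* A condition [(true, e)] stands for [e = 0], and [(false, e)] for [0 < e]. *)
Definition check (h o : nat) (c : bool * pexp) : stmt :=
  Seq (cexp h o 2 c.2)
    (if c.1 then If (TLt 1 2) clear0 (If (TLt 2 1) clear0 Skip)
     else If (TLt 1 2) Skip clear0).

(* Register 0 := whether the vector whose size is in index register 1 has size [n]
   and satisfies all conditions. *)
Definition check_all (h o n : nat) (cs : seq (bool * pexp)) : stmt :=
  seqs [:: consti 0 One; copyi 3 9; incs 3 n;
    If (TIdx 1 3) (If (TIdx 3 1) Skip clear0) clear0;
    seqs [seq check h o c | c <- cs]].

Definition return0 := seqs [:: storei 9 0; copyi 0 9; inci 0].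

Section Checks.
Variable R : realType.
Variables (O : oracle R) (own host : seq R).
Local Notation wp := (wp O own host).
Implicit Types (Q : post R) (r m : nat -> R) (ix : nat -> nat).

Definition holds (w : seq R) (c : bool * pexp) : bool :=
  if c.1 then peval (host ++ own ++ w) c.2 == 0 else 0 < peval (host ++ own ++ w) c.2.

Lemma wp_incs i n Q r ix m :
  Q r (fun k => if k == i then (ix i + n)%N else ix k) m -> wp (incs i n) Q r ix m.
Proof.
elim: n ix => [|n IH] ix h /=.
  rewrite (_ : ix = fun k => if k == i then (ix i + 0)%N else ix k) //.
  by apply/funext => k; case: eqP => [->|//]; rewrite addn0.
apply: IH; rewrite (_ : (fun k => _) = fun k => if k == i then (ix i + n.+1)%N else ix k) //.
by apply/funext => k /=; rewrite eqxx; case: eqP => // _; rewrite addSnnS.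
Qed.

Lemma wp_cexp d e Q r ix m w : ix 9%N = 0%N -> (forall k, m k = w`_k) ->
  (forall r' ix', r' d = peval (host ++ own ++ w) e ->
    (forall k, (k < d)%N -> r' k = r k) -> (forall i, i != 2%N -> ix' i = ix i) -> Q r' ix' m) ->
  wp (cexp (size host) (size own) d e) Q r ix m.
Proof.
move=> ix9 hm; elim: e d Q r ix ix9 => [i||a IHa b IHb|a IHa b IHb] d Q r ix ix9 hQ.
- rewrite /=; case: ltnP => hi.
    apply: hQ => //= [|k kd]; last by rewrite ltn_eqF.
    by rewrite eqxx nth_cat hi.
  case: ltnP => ho.
    apply: hQ => //= [|k kd]; last by rewrite ltn_eqF.
    by rewrite eqxx nth_cat ltnNge hi /= nth_cat ltn_subLR // ho.
  apply: wp_incs => /=; apply: hQ => [|k kd|k /negPf k2] /=.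
  + rewrite eqxx hm !nth_cat ltnNge hi /= ltn_subLR // ltnNge ho /=.
    by rewrite ix9 add0n subnDA.
  + by rewrite ltn_eqF.
  + by rewrite k2.
- by apply: hQ => //= [|k kd]; rewrite ?eqxx // ltn_eqF.
- apply: IHa => //= r1 ix1 h1 hr1 hix1; apply: IHb => [|r2 ix2 h2 hr2 hix2]; first by rewrite hix1.
  apply: hQ => [|k kd|k k2] /=.
  + by rewrite eqxx hr2 // h1 h2.
  + by rewrite ltn_eqF // hr2 ?hr1 // ltnW.
  + by rewrite hix2 ?hix1.
- apply: IHa => //= r1 ix1 h1 hr1 hix1; apply: IHb => [|r2 ix2 h2 hr2 hix2]; first by rewrite hix1.
  apply: hQ => [|k kd|k k2] /=.
  + by rewrite eqxx hr2 // h1 h2.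
  + by rewrite ltn_eqF // hr2 ?hr1 // ltnW.
  + by rewrite hix2 ?hix1.
Qed.

Lemma wp_check c Q r ix m w : ix 9%N = 0%N -> (forall k, m k = w`_k) -> r 1%N = 0 ->
  (forall r' ix', r' 0%N = (if holds w c then r 0%N else 0) -> r' 1%N = 0 ->
    (forall i, i != 2%N -> ix' i = ix i) -> Q r' ix' m) ->
  wp (check (size host) (size own) c) Q r ix m.
Proof.
move=> ix9 hm r1 hQ; rewrite /check /=.
apply: wp_cexp (hm) _ => // r' ix' h hr hix.
have r'0 : r' 0%N = r 0%N by exact: hr.
have r'1 : r' 1%N = 0 by rewrite hr.
move: hQ; rewrite /holds -h; case: (c.1) => /= hQ; rewrite r'1.
  by case: ltgtP => h2; apply: hQ => //=; rewrite ?subrr // ?(gt_eqF h2) ?(lt_eqF h2) // -h2 eqxx.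
by case: ifP => h2; apply: hQ; rewrite //= ?h2 // subrr.
Qed.

Lemma wp_checks cs Q r ix m w : ix 9%N = 0%N -> (forall k, m k = w`_k) -> r 1%N = 0 ->
  (forall r' ix', r' 0%N = (if all (holds w) cs then r 0%N else 0) -> r' 1%N = 0 ->
    (forall i, i != 2%N -> ix' i = ix i) -> Q r' ix' m) ->
  wp (seqs [seq check (size host) (size own) c | c <- cs]) Q r ix m.
Proof.
elim: cs Q r ix => [|c cs IH] Q r ix ix9 hm r1 hQ /=; first exact: hQ.
apply: (wp_check (w := w)) => // r' ix' r'0 r'1 hix; apply: IH => //; first by rewrite hix.
move=> r2 ix2 h0 h1 h2; apply: hQ => //; last by move=> i i2; rewrite h2 ?hix.
by rewrite h0 r'0 /=; case: (holds w c); case: ifP.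
Qed.

Lemma wp_check_all n cs Q r ix m w : ix 9%N = 0%N -> (forall k, m k = w`_k) -> r 1%N = 0 ->
  (forall r' ix', r' 0%N = (if (ix 1%N == n) && all (holds w) cs then 1 else 0) ->
    r' 1%N = 0 -> (forall i, i != 2%N -> i != 3%N -> ix' i = ix i) -> Q r' ix' m) ->
  wp (check_all (size host) (size own) n cs) Q r ix m.
Proof.
move=> ix9 hm r1 hQ /=; apply: wp_incs => /=; rewrite ix9 add0n.
set ix' := (fun k : nat => if k == 3%N then n else _).
have rest r' : r' 1%N = 0 -> r' 0%N = (if ix 1%N == n then 1 else 0) ->
    wp (seqs [seq check (size host) (size own) c | c <- cs]) Q r' ix' m.
  move=> r'1 r'0; apply: (wp_checks (w := w)) => // r2 ix2 h0 h1 h2; apply: hQ => //.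
    by rewrite h0 r'0; case: (ix 1%N == n); case: (all _ _).
  by move=> i i2 i3; rewrite h2 // /ix' (negPf i3).
case: ltngtP => h.
- by apply: rest => //=; rewrite subrr (ltn_eqF h).
- by apply: rest => //=; rewrite subrr (gtn_eqF h).
- by apply: rest => //=; rewrite h eqxx.
Qed.

End Checks.

(** * Complexity as transcendence degree *)

Section Complexity.
Variable R : realType.
Implicit Types (S x z w p : seq R) (U : control).

(** The inequality places [t] within distance [1/q] of [(a - b)/q]. A rational interval keeps the
    condition an integer polynomial; [a] and [b] together represent a signed integer. *)
Lemma isolate S y : inalg S y -> exists e a b q, forall t,
  (peval (rcons S t) e = 0 /\ 0 < 1 - (q%:R * t + b%:R - a%:R) ^+ 2) <-> t = y.
Proof.
move=> [e e0 en0]; have [k [q qy qE]] := multiplicity_XsubC (upoly S e) y.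
rewrite en0 /= in qy.
(* Within distance [d] of [y] the cofactor [q] has no zero, so [y] is the only root of the relation
   there. *)
have /nbhs_ballP[d /= d0 hd] : \forall t \near y, `|q.[y] - q.[t]| < `|q.[y]|.
  by move/cvgrPdist_lt : (@continuous_horner _ q y); apply; rewrite normr_gt0.
have hroot t : `|y - t| < d -> peval (rcons S t) e = 0 -> t = y.
  move=> /hd /= ht; rewrite -horner_upoly qE hornerM horner_exp hornerXsubC.
  move=> /eqP; rewrite mulf_eq0 expf_eq0 => /orP[/eqP qt|/andP[_]].
    by rewrite qt subr0 ltxx in ht.
  by rewrite subr_eq0 => /eqP.
(* Two points of an interval of length [2/N] are less than [d] apart. *)
pose N := Num.bound (2 / d).
have hN : 2 / d < N%:R by apply: archi_boundP; rewrite divr_ge0 // ltW.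
have N0 : 0 < N%:R :> R by apply: lt_trans hN; rewrite divr_gt0.
(* The shift by [B] makes [N * y + B] nonnegative, so that [truncn] gives its integer part. *)
pose B := Num.bound `|N%:R * y|.
have hB : `|N%:R * y| < B%:R by exact: archi_boundP.
have yB : 0 <= N%:R * y + B%:R.
  by have := ler_norm (- (N%:R * y)); rewrite normrN; lra.
have /andP[h1 h2] := truncn_itv yB; set A := Num.truncn _ in h1 h2.
exists e, A, B, N => t; split=> [[et ht]|->]; last first.
  split=> //; rewrite -natr1 in h2; set u := N%:R * y + B%:R - A%:R.
  have u0 : 0 <= u by rewrite /u; lra.
  have u1 : u < 1 by rewrite /u; lra.
  by nra.
apply: hroot => //; rewrite -natr1 in h2.
have hu : -1 < N%:R * t + B%:R - A%:R < 1.
  by move: ht; set u := _ - A%:R => ht; apply/andP; split; nra.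
have : `|N%:R * (y - t)| < 2 by rewrite ltr_norml mulrBr; move: hu; lra.
rewrite normrM gtr0_norm // => h; rewrite ltr_pdivrMr // in hN.
rewrite -(ltr_pM2l N0); apply: lt_trans h _; move: hN; lra.
Qed.

Lemma isolating_conditions S x : (forall a, a \in x -> inalg S a) ->
  exists cs : seq (bool * pexp), forall w, size w = size x ->
    all (holds [::] S w) cs = (w == x).
Proof.
elim/last_ind: x => [|x a IH] h; first by exists [::] => w /size0nil->.
have [|cs hcs] := IH; first by move=> b bx; apply: h; rewrite mem_rcons inE bx orbT.
have [|e [A [B [N hN]]]] := @isolate S a; first by apply: h; rewrite mem_rcons mem_head.
(* The last variable of [e] becomes the last coordinate of the input, at position [size S + size x];
   variables beyond it still read 0. *)
pose f i := if (i < size S)%N then i else if i == size S then (size S + size x)%N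
            else (size S + size x).+1.
pose L := PSub (PAdd (PMul (pnat N) (PVar (size S + size x))) (pnat B)) (pnat A).
exists ([seq (c.1, ptrunc (size S + size x) 1 c.2) | c <- cs] ++
  [:: (true, prename f e); (false, PSub POne (PMul L L))]).
case/lastP=> [|w b]; rewrite !size_rcons // => -[sw].
rewrite eqseq_rcons -hcs // all_cat all_map; congr (_ && _).
  apply: eq_all => -[k c] /=; rewrite /holds /= -!cats1 catA.
  by rewrite -sw -size_cat (peval_trunc (S ++ w) [:: b]).
have fE : peval (S ++ rcons w b) (prename f e) = peval (rcons S b) e.
  apply: peval_rename => i; rewrite /f -rcons_cat !nth_rcons !nth_cat !size_cat sw.
  case: (ltngtP i (size S)) => hi; rewrite ?hi ?ltnn ?eqxx //.
    by rewrite ltn_addr.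
  by rewrite ltnNge leqnSn /= gtn_eqF.
have LE : peval (S ++ rcons w b) L = N%:R * b + B%:R - A%:R.
  rewrite /L /= -/(PAdd _ _) subrr sub0r opprK !peval_nat.
  by rewrite -rcons_cat nth_rcons size_cat sw ltnn eqxx.
rewrite /= andbT -[holds _ _ _ (true, _)]/(peval (S ++ rcons w b) (prename f e) == 0).
rewrite -[holds _ _ _ (false, _)]/(0 < 1 - peval (S ++ rcons w b) L * peval (S ++ rcons w b) L).
rewrite fE LE -expr2.
by apply/andP/eqP => [[/eqP h1 h2]|/hN[/eqP h1 h2]] //; apply/hN.
Qed.

Lemma min_sizeP (P : set (seq R)) p :
  P p -> (forall p', P p' -> (size p <= size p')%N) -> min_size P = Some (size p).
Proof.
move=> Pp hmin; rewrite /min_size; case: pselect => [h|[]]; last first.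
  by exists (size p); apply/asboolP; exists p.
case: ex_minnP => n /asboolP[p' Pp' <-] nmin; congr Some; apply/eqP.
by rewrite eqn_leq hmin // nmin //; apply/asboolP; exists p.
Qed.

Lemma onth_size (T : Type) (s : seq T) n : (size s <= n)%N -> onth s n = None.
Proof. by elim: s n => [|x s IH] [|n] //= /IH. Qed.

Lemma returns_in_fun (O : oracle R) P own host x y y' :
  returns_in O P own host x y -> returns_in O P own host x y' -> y = y'.
Proof.
have stable t k : (size P <= pc (run O P own host x t))%N ->
    run O P own host x (k + t) = run O P own host x t.
  move=> h; elim: k => // k IH; rewrite /run addSn iterS -/(run _ _ _ _ _ _) IH.
  by rewrite /step onth_size.
move=> [t ht <-] [t' ht' <-].
by rewrite -(stable _ t' ht) -(stable _ t ht') addnC.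
Qed.

Lemma charfun_in (L : set (seq R)) x : L x -> charfun L x = [:: 1].
Proof. by move=> h; rewrite /charfun asboolT. Qed.

Lemma charfun_out (L : set (seq R)) x : ~ L x -> charfun L x = [:: 0].
Proof. by move=> h; rewrite /charfun asboolF. Qed.

(** Equality with [y] consists of finitely many locally stable conditions: the size, and one
    equation per entry. *)
Lemma good_vector_const D x (W : set (seq R)) (G : seq R -> seq R) y : W x ->
  (forall k, good D x W (fun=> y`_k)) -> good_vector D x W G -> G x = y ->
  near D x W (fun w => G w = y).
Proof.
move=> Wx yD [sG gG] Gx; move: (sG); rewrite Gx => sG'.
suff h n : near D x W (fun w => forall k, (k < n)%N -> (G w)`_k = y`_k).
  apply: near_mono (near_and sG' (h (size y))) => w _ [sw hw].
  by apply: (@eq_from_nth _ 0) => // i; rewrite sw; exact: hw.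
elim: n => [|n IH]; first exact: near_true.
have gn := good_sub (gG n) (yD n).
have := good_eq0 Wx gn; rewrite Gx subrr => /(_ erefl) hn.
apply: near_mono (near_and IH hn) => w _ [h1 /eqP]; rewrite subr_eq0 => /eqP h2 k.
by rewrite ltnS leq_eqVlt => /orP[/eqP->|/h1].
Qed.

Lemma program_decides_inalg U z p x :
  program_decides U z p [set x] -> forall a, a \in x -> inalg (z ++ p) a.
Proof.
move=> hU; apply: contrapT => nalg.
have Tx : [set: seq R] x by [].
have gF : good_vector (z ++ p) x setT (program_input p).
  split=> [|[|k]].
  - exists PZero, 1; rewrite pevalZero; split=> // w _ [sw _] _.
    by rewrite /= !size_cat sw.
  - exact: good_nat.
  case: (ltnP k (size p)) => hk.
    have pD : p`_k \in z ++ p by rewrite mem_cat mem_nth ?orbT.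
    apply: good_near (good_mem x setT pD).
    by apply: near_true => w _; rewrite /= nth_cat hk.
  apply: good_near (good_var (z ++ p) x setT (k - size p)).
  by apply: near_true => w _; rewrite /= nth_cat ltnNge hk.
have := hU x; rewrite charfun_in // => hx.
have hO F : good_vector (z ++ p) x setT F ->
    near (z ++ p) x setT (fun w => no_oracle (F w) = no_oracle (F x)) /\
    (forall v, no_oracle (F x) = Some v -> forall k, good (z ++ p) x setT (fun=> v`_k)).
  by move=> _; split=> //; exact: near_true.
have zD : {subset z <= z ++ p} by move=> a az; rewrite mem_cat az.
have nD : {subset [::] <= z ++ p} by [].
have [G [gG Gx hG]] := returns_in_near Tx nD zD hO gF hx.
have g1 k : good (z ++ p) x setT (fun=> [:: 1]`_k).
  by case: k => [|k]; [exact: (good_nat _ _ _ 1)|rewrite nth_default //; exact: (good_nat _ _ _ 0)].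
have [e [eta [eta0 ex he]]] := near_and hG (good_vector_const Tx g1 gG Gx).
have [w [wx cw ew]] := zero_not_isolated nalg ex eta0.
have [//|] := he w _ cw ew.
move=> h1 G1; rewrite G1 in h1.
have h0 := hU w; rewrite charfun_out // in h0.
by have [/eqP] := returns_in_fun h1 h0; rewrite oner_eq0.
Qed.

Lemma decide_singleton z c x : (forall a, a \in x -> inalg (z ++ c) a) ->
  exists M : control, forall w, returns M c z w (charfun [set x] w).
Proof.
move=> /isolating_conditions[cs hcs].
pose s := seqs [:: copyi 1 0; check_all (size z) (size c) (size x) cs; return0].
have sp : plain s.
  rewrite /s /= andbT.
  have ps l : all plain l -> plain (seqs l) by elim: l => //= a l IH /andP[-> /IH].
  have pi i n : plain (incs i n) by elim: n.
  have pe d e : plain (cexp (size z) (size c) d e).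
    elim: e d => //= [i|a IHa b IHb|a IHa b IHb] d; last 2 first.
    - by rewrite IHa IHb.
    - by rewrite IHa IHb.
    by case: ifP => // _; case: ifP => //= _; rewrite pi.
  rewrite pi ps // all_map; apply/allP => -[b e] _ /=.
  by rewrite pe; case: b.
exists (map strip (compile 0 s)) => w; rewrite /returns compile_plain //.
apply: returns_wp; rewrite /s /=.
apply: (@wp_check_all _ _ c z _ _ _ _ _ _ w) => //= r ix r0 r1 hix.
(* For the conditions, host and own constants form the single list [z ++ c]. *)
rewrite (eq_all (a2 := holds [::] (z ++ c) w)) in r0; last first.
  by move=> b; rewrite /holds /= catA.
rewrite hix //= /charfun.
have -> : [:: if `[< [set x] w >] then 1 else 0] = [:: r 0%N] :> seq R.
  rewrite r0; case: asboolP => [->|wx]; first by rewrite eqxx hcs // eqxx.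
  by case: eqP => //= sw; rewrite hcs //; case: eqP.
by [].
Qed.

(** A transcendence basis used as own constants gives the upper bound; [encode] turns [t] constants
    into [maxn 1 t] reals. The lower bound is [steinitz] applied to a program that decides the
    singleton. *)
Lemma KdE pair z U x : universal pair z U ->
  Kd U z x = Some (if `[< program_decides U z [::] [set x] >] then 0
                   else maxn 1 (size (tbasis z x)))%N.
Proof.
move=> hU; case: asboolP => [h|nh]; first exact: (min_sizeP h).
have [M hM] := decide_singleton (fun a => @tbasis_span _ z x a).
pose p := encode pair M (tbasis z x).
have sp : size p = maxn 1 (size (tbasis z x)).
  by rewrite /p /encode /= size_behead; lia.
rewrite -sp; apply: min_sizeP => [w|p' hp']; first by apply/hU.
rewrite sp geq_max; apply/andP; split.
  by case: p' hp' => // /nh.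
apply: (@steinitz _ z); first exact: indep_tbasis.
by move=> a /mem_tbasis; exact: program_decides_inalg.
Qed.

End Complexity.

(** * The Cantor set *)

Section Cantor.
Variable R : realType.
Implicit Types (x y : R) (t : nat -> R).

Definition ternary t x := (forall n, t n = 0 \/ t n = 2) /\
  (fun N => \sum_(1 <= n < N.+1) t n * 3 ^- n) @ \oo --> x.

Lemma cantor_ternary x : cantor_third x <-> exists t, ternary t x.
Proof. by split=> [[t h1 h2]|[t [h1 h2]]]; exists t. Qed.

(** On the Cantor set this map shifts the ternary digits. A point strictly between 1/3 and 2/3 is
    sent below 0. *)
Definition cantor_map x : R := if 3 * x <= 1 then 3 * x else 3 * x - 2.

Lemma ternary_sum_bounds t N : (forall n, t n = 0 \/ t n = 2) ->
  0 <= \sum_(1 <= n < N.+1) t n * 3 ^- n <= 1 - 3 ^- N.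
Proof.
move=> ht; elim: N => [|N IH]; first by rewrite big_geq // expr0 invr1 subrr lexx.
rewrite big_nat_recr //=; move: IH; set s := \sum_(_ <= _ < _) _.
have p0 : 0 < (3 : R) ^- N.+1 by rewrite invr_gt0 exprn_gt0.
have -> : (3 : R) ^- N = 3 * 3 ^- N.+1 by rewrite exprS invfM mulVKf.
by case: (ht N.+1) => ->; move: p0; set q := _ ^- _ => p0; lra.
Qed.

Lemma ternary_unit t x : ternary t x -> 0 <= x <= 1.
Proof.
move=> [ht hx]; have hc : cvgn (fun N => \sum_(1 <= n < N.+1) t n * 3 ^- n).
  by apply/cvg_ex; exists x.
apply/andP; rewrite -(cvg_lim _ hx) //; split.
  by apply: limr_ge => //; apply: nearW => N; have /andP[] := ternary_sum_bounds N ht.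
apply: limr_le => //; apply: nearW => N; have /andP[_] := ternary_sum_bounds N ht.
move=> /le_trans; apply; rewrite lerBlDr lerDl invr_ge0 exprn_ge0 //.
Qed.

Lemma ternary_shift t x : ternary t x -> ternary (fun n => t n.+1) (3 * x - t 1%N).
Proof.
move=> [ht hx]; split=> [n|]; first exact: ht.
have -> : (fun N => \sum_(1 <= n < N.+1) t n.+1 * 3 ^- n) =
    (fun N => 3 * (\sum_(1 <= n < N.+2) t n * 3 ^- n) - t 1%N).
  apply/funext => N; rewrite [in RHS]big_ltn // mulrDr expr1 mulrC mulfVK // addrAC subrr add0r.
  rewrite [in RHS]big_add1 /= mulr_sumr; apply: eq_bigr => n _.
  by rewrite exprS invfM mulrCA mulVKf.
apply: cvgB; last exact: cvg_cst.
apply: cvgMr; rewrite -(cvg_shiftS (fun N => \sum_(1 <= n < N.+1) t n * 3 ^- n)) in hx.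
exact: hx.
Qed.

(** The shifted expansion has its value in [0,1], so [x] determines its first digit. *)
Lemma ternary_map t x : ternary t x ->
  ternary (fun n => t n.+1) (cantor_map x) /\ (3 * x <= 1) = (t 1%N == 0).
Proof.
move=> hx; have h := ternary_shift hx; have /andP[h0 h1] := ternary_unit h.
rewrite /cantor_map; case: hx => ht _; case: (ht 1%N) => t1; rewrite t1 in h h0 h1 *.
  by rewrite eqxx -(subr0 (3 * x)) h1.
have -> : (3 * x <= 1) = false by apply/negbTE; rewrite -ltNge; lra.
by split=> //; rewrite pnatr_eq0.
Qed.

Lemma ternary_iter t x n : ternary t x ->
  ternary (fun k => t (n + k)%N) (iter n cantor_map x) /\
  (3 * iter n cantor_map x <= 1) = (t n.+1 == 0).
Proof.
move=> hx; suff h : ternary (fun k => t (n + k)%N) (iter n cantor_map x).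
  by have [_ ->] := ternary_map h; rewrite addn1.
elim: n => [|n IH]; first exact: hx.
have [h _] := ternary_map IH.
by rewrite iterS; under eq_fun do rewrite addSnnS.
Qed.

Lemma cantorP x : cantor_third x <-> forall n, 0 <= iter n cantor_map x <= 1.
Proof.
rewrite cantor_ternary; split=> [[t hx] n|hx].
  by have [h _] := ternary_iter n hx; exact: ternary_unit h.
pose t n := if n is n'.+1 then if 3 * iter n' cantor_map x <= 1 then 0 else 2 else 0 : R.
(* The error of a partial sum is [3 ^- N] times the [N]-th iterate, which stays bounded. *)
have tE N : \sum_(1 <= n < N.+1) t n * 3 ^- n = x - 3 ^- N * iter N cantor_map x.
  elim: N => [|N IH]; first by rewrite big_geq // expr0 invr1 mul1r subrr.
  rewrite big_nat_recr //= IH exprS invfM /cantor_map.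
  have n3 : (3 : R) != 0 by rewrite pnatr_eq0.
  have nN : (3 : R) ^+ N != 0 by rewrite expf_neq0.
  by case: ifP => _; field; rewrite nN.
exists t; split=> [[|n]|]; [by left|by rewrite /t; case: ifP; [left|right]|].
apply/cvgrPdist_le => e e0.
have h3 : (fun n => (3^-1 : R) ^+ n) @ \oo --> 0.
  by apply: cvg_expr; rewrite ger0_norm ?invr_ge0 // invf_lt1 // ltr1n.
move/cvgrPdist_le : h3 => /(_ e e0); apply: filterS => N.
rewrite tE subKr sub0r normrN -exprVn => hN.
have /andP[y0 y1] := hx N; rewrite normrM; apply: le_trans hN.
by rewrite ler_piMr // ger0_norm.
Qed.

(* Cantor's diagonal argument on ternary digits. *)
Lemma cantor_avoid (f : nat -> R) : exists2 x, cantor_third x & forall n, f n <> x.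
Proof.
pose t n := if n is n'.+1 then if 3 * iter n' cantor_map (f n') <= 1 then 2 else 0 else 0 : R.
have ht n : t n = 0 \/ t n = 2.
  by case: n => [|n]; [left|rewrite /t; case: ifP; [right|left]].
pose s N := \sum_(1 <= n < N.+1) t n * 3 ^- n.
have cs : cvgn s.
  apply: nondecreasing_is_cvgn.
    apply/nondecreasing_seqP => N; rewrite /s [leRHS]big_nat_recr //= lerDl.
    by rewrite mulr_ge0 ?invr_ge0 ?exprn_ge0 //; case: ifP.
  exists 1 => _ [N _ <-]; have /andP[_] := ternary_sum_bounds N ht.
  by move=> /le_trans; apply; rewrite lerBlDr lerDl invr_ge0 exprn_ge0.
have hx : ternary t (limn s) by split.
exists (limn s); first by apply/cantor_ternary; exists t.
move=> n fn; have [_] := ternary_iter n hx.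
by rewrite -fn /t; case: ifP => _; rewrite ?eqxx // pnatr_eq0.
Qed.

(** The map from [u] to [a + 3 ^- N * u] is the inverse branch of the [N]-th iterate of [cantor_map]
    along the digits of [x]. It sends [0,1] onto the triadic interval of level [N] that contains
    [x]. *)
Lemma cantor_gap x N : cantor_third x -> exists a, forall u, 0 <= u <= 1 ->
  [/\ `|a + 3 ^- N * u - x| <= 3 ^- N, 0 <= a + 3 ^- N * u <= 1 &
    cantor_third (a + 3 ^- N * u) -> cantor_third u].
Proof.
elim: N x => [|N IH] x hx.
  exists 0 => u hu; rewrite add0r expr0 invr1 mul1r; split=> //.
  by have := (cantorP x).1 hx 0%N; rewrite ler_norml /=; lra.
have [t tx] := (cantor_ternary x).1 hx; have [tx' xE] := ternary_map tx.
have [|a ha] := IH (cantor_map x); first by apply/cantor_ternary; exists (fun n => t n.+1).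
have t1 := tx.1 1%N.
have {}xE : x = (cantor_map x + t 1%N) / 3.
  rewrite /cantor_map xE; case: t1 => ->; rewrite ?eqxx ?pnatr_eq0 /=; lra.
exists ((a + t 1%N) / 3) => u /ha [].
have -> : (a + t 1%N) / 3 + 3 ^- N.+1 * u = ((a + 3 ^- N * u) + t 1%N) / 3.
  by rewrite exprS invfM; set q := 3 ^- N; lra.
set w := a + _ => h1 h2 h3; split.
- rewrite {1}xE -mulrBl opprD addrACA subrr addr0 normrM exprS invfM mulrC.
  by rewrite ger0_norm ?invr_ge0 // ler_wpM2l ?invr_ge0.
- by case: t1 => ->; lra.
move=> /cantorP hc; apply: h3; apply/cantorP => n; have := hc n.+1.
rewrite iterSr [cantor_map (_ / 3)](_ : _ = w) // /cantor_map.
by case: t1 => ->; case: ifP; lra.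
Qed.

Lemma cantor_complement_avoid (f : nat -> R) x delta : cantor_third x -> 0 < delta ->
  exists w, [/\ ~ cantor_third w, `|w - x| < delta & forall n, f n <> w].
Proof.
move=> hx d0.
have [N hN] : exists N, (3 : R) ^- N < delta.
  have h3 : (fun n => (3^-1 : R) ^+ n) @ \oo --> 0.
    by apply: cvg_expr; rewrite ger0_norm ?invr_ge0 // invf_lt1 // ltr1n.
  move/cvgrPdist_lt : h3 => /(_ _ d0) [N _ /(_ N (leqnn N))].
  by rewrite sub0r normrN ger0_norm ?exprn_ge0 ?invr_ge0 // exprVn => h; exists N.
have [a ha] := cantor_gap N hx.
(* The point sought is [a + 3 ^- N * u] with [u = (4 + v) / 9], which lies in [4/9, 5/9] and thus in
   the removed middle third. Choosing [v] in the Cantor set reuses the diagonal argument; the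
   sequence avoided is [f] pulled back along this map. *)
have [v hv fv] := cantor_avoid (fun n => (f n - a) / 3 ^- N * 9 - 4).
have := (cantorP v).1 hv 0%N => /= v01.
pose u := (4 + v) / 9; have u01 : 0 <= u <= 1 by rewrite /u; lra.
have [h1 h2 h3] := ha u u01; exists (a + 3 ^- N * u); split.
- move=> /h3 /cantorP /(_ 1%N); rewrite /= /cantor_map /u; case: ifP; lra.
- exact: le_lt_trans h1 hN.
move=> n fn; apply: (fv n); rewrite fn /u.
have nN : (3 : R) ^+ N != 0 by rewrite expf_neq0 // pnatr_eq0.
by field; rewrite nN.
Qed.

End Cantor.

(** * Semi-deciding the complement of the Cantor set *)

Section CantorMachine.
Variable R : realType.

(* Iterates [cantor_map] on register 0 until it leaves the unit interval;
   the first six instructions are left to the caller. *)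
Definition cantor_loop (pre : 6.-tuple instr) : control :=
  pre ++ [:: Const 2 One; Arith Defs.Add 4 2 2; Arith Defs.Add 3 4 2;
    JumpLt 0 1 16; JumpLt 2 0 16; Arith Defs.Mul 0 0 3; JumpLt 2 0 14; JumpIdxLe 0 0 9;
    Arith Defs.Sub 0 0 4; JumpIdxLe 0 0 9].

(** The invariant need only recur. A halted state in between would be a fixed point and would
    prevent the recurrence. *)
Lemma never_halts (f : config R -> config R) N (I : config R -> Prop) :
  (forall s, (N <= pc s)%N -> f s = s) ->
  (forall s, I s -> (pc s < N)%N /\ exists k, I (iter k.+1 f s)) ->
  forall t s, I s -> (pc (iter t f s) < N)%N.
Proof.
move=> stable hI; elim/ltn_ind => t IH s Is; have [hs [k Ik]] := hI s Is.
case: (ltnP t k.+1) => ht; last first.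
  by rewrite -(subnK ht) iterD; apply: IH Ik; rewrite ltn_subrL (leq_trans _ ht).
rewrite ltnNge; apply/negP => h.
have st j : iter j f (iter t f s) = iter t f s.
  by elim: j => // j; rewrite iterS => ->; exact: stable.
have [] := hI _ Ik; rewrite -(subnK (ltnW ht)) iterD st => h'.
by rewrite ltnNge h in h'.
Qed.

Lemma cantor_loopP pre (own host : seq R) r ix m : r 1%N = 0 ->
  (exists t, (16 <= pc (iter t (step (@no_oracle R) (map Plain (cantor_loop pre)) own host)
    (Config 6 r ix m)))%N) <-> ~ cantor_third (r 0%N).
Proof.
case: pre => [[|a0 [|a1 [|a2 [|a3 [|a4 [|a5 [|]]]]]]] //= hsize].
move=> r1; set f := step _ _ _ _.
pose good (r : nat -> R) y := [/\ r 0%N = y, r 1%N = 0, r 2%N = 1, r 3%N = 3 & r 4%N = 2].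
have f9 r0 : f (Config 9 r0 ix m) = Config (if r0 0%N < r0 1%N then 16 else 10) r0 ix m.
  by [].
have f10 r0 : f (Config 10 r0 ix m) = Config (if r0 2%N < r0 0%N then 16 else 11) r0 ix m.
  by [].
have f11 r0 : f (Config 11 r0 ix m) = Config 12 [eta r0 with 0%N |-> r0 0%N * r0 3%N] ix m.
  by [].
have f12 r0 : f (Config 12 r0 ix m) = Config (if r0 2%N < r0 0%N then 14 else 13) r0 ix m.
  by [].
have f13 r0 : f (Config 13 r0 ix m) = Config 9 r0 ix m by rewrite /f /step /= leqnn.
have f14 r0 : f (Config 14 r0 ix m) = Config 15 [eta r0 with 0%N |-> r0 0%N - r0 4%N] ix m.
  by [].
have f15 r0 : f (Config 15 r0 ix m) = Config 9 r0 ix m by rewrite /f /step /= leqnn.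
have start : exists r', good r' (r 0%N) /\ iter 3 f (Config 6 r ix m) = Config 9 r' ix m.
  by eexists; split; last reflexivity; split=> //=; ring.
have loop r' y : good r' y -> 0 <= y <= 1 -> exists k r'', good r'' (cantor_map y) /\
    iter k.+1 f (Config 9 r' ix m) = Config 9 r'' ix m.
  move=> [h0 h1 h2 h3 h4] /andP[y0 y1].
  have e0 : (r' 0%N < r' 1%N) = false by rewrite h0 h1 ltNge y0.
  have e1 : (r' 2%N < r' 0%N) = false by rewrite h0 h2 ltNge y1.
  have e2 : (r' 2%N < r' 0%N * r' 3%N) = ~~ (3 * y <= 1) by rewrite h0 h2 h3 mulrC ltNge.
  rewrite /cantor_map; case h5 : (3 * y <= 1) e2 => /= e2.
    exists 4%N, [eta r' with 0%N |-> r' 0%N * r' 3%N]; split.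
      by split=> //=; rewrite h0 h3 mulrC.
    by rewrite -[LHS]/(f (f (f (f (f _))))) f9 e0 f10 e1 f11 f12 /= e2 f13.
  exists 5%N, [eta [eta r' with 0%N |-> r' 0%N * r' 3%N] with 0%N |-> r' 0%N * r' 3%N - r' 4%N].
  split; first by split=> //=; rewrite h0 h3 h4 mulrC.
  by rewrite -[LHS]/(f (f (f (f (f (f _)))))) f9 e0 f10 e1 f11 f12 /= e2 f14 f15.
have exit r' y : good r' y -> ~ (0 <= y <= 1) ->
    exists t, (16 <= pc (iter t f (Config 9 r' ix m)))%N.
  move=> [h0 h1 h2 h3 h4] /negP; rewrite negb_and -!ltNge => /orP[y0|y1].
    by exists 1%N; rewrite -[iter _ _ _]/(f _) f9 h0 h1 y0.
  exists 2%N; rewrite -[iter _ _ _]/(f (f _)) f9 h0 h1; case: ifP => // _.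
  by rewrite f10 h0 h2 y1.
have [r' [gr' e3]] := start; split=> [[t ht]|nC]; last first.
  have halts9 n r'' y : good r'' y -> ~ (0 <= iter n (@cantor_map R) y <= 1) ->
      exists t, (16 <= pc (iter t f (Config 9 r'' ix m)))%N.
    elim: n r'' y => [|n IH] r'' y g''; first exact: exit.
    rewrite iterSr => hn; have [yu|] := pselect (0 <= y <= 1); last exact: exit.
    have [k [r3 [g3 e]]] := loop _ _ g'' yu; have [t ht] := IH _ _ g3 hn.
    by exists (t + k.+1)%N; rewrite iterD e.
  have /existsNP[n hn] : ~ forall n, 0 <= iter n (@cantor_map R) (r 0%N) <= 1.
    by move=> /cantorP.
  have [t ht] := halts9 n r' _ gr' hn.
  by exists (t + 3)%N; rewrite iterD e3.
move=> hC.
pose I s := (exists r'' y, [/\ s = Config 9 r'' ix m, good r'' y & cantor_third y])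
  \/ s = Config 6 r ix m.
suff : (pc (iter t f (Config 6 r ix m)) < 16)%N by rewrite ltnNge ht.
apply: (@never_halts f 16 I) => [s hs|s|]; last by right.
  by rewrite /f /step onth_size.
move=> [[r'' [y [-> gy /cantorP Cy]]]|->]; split=> //; last first.
  by exists 2%N; left; exists r', (r 0%N); split=> //; exact: contrapT.
have [k [r3 [g3 e]]] := loop _ _ gy (Cy 0%N).
exists k; left; exists r3, (cantor_map y); split=> //.
by apply/cantorP => n; rewrite -iterSr.
Qed.

Lemma halts_iterD (P : ocontrol) (own host x : seq R) k s :
  run (@no_oracle R) P own host x k = s -> (pc s < size P)%N ->
  halts_in (@no_oracle R) P own host x <->
  exists t, (size P <= pc (iter t (step (@no_oracle R) P own host) s))%N.
Proof.
move=> <- hs; split=> [[t ht]|[t ht]]; last by exists (t + k)%N; rewrite /run iterD.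
exists (t - k)%N; rewrite /run -iterD; case: (leqP k t) => h; first by rewrite subnK.
move: hs; rewrite /run -(subnK (ltnW h)) iterD; set s' := iter t _ _ in ht *.
have -> j : iter j (step (@no_oracle R) P own host) s' = s'.
  by elim: j => // j IH; rewrite iterS IH /step onth_size.
by rewrite ltnNge ht.
Qed.

(* Loops on inputs of size other than 1. *)
Definition cantor_input : 6.-tuple instr :=
  [tuple IdxInc 1; JumpIdxLe 0 1 3; JumpIdxLe 0 0 2; JumpIdxLe 1 0 5; JumpIdxLe 0 0 4; Fetch 0 2].

Lemma cantor_complement_semidecidable : bss_semidecidable (lang1 (~` @cantor_third R)).
Proof.
exists (cantor_loop cantor_input), [::] => x.
set P := map Plain (cantor_loop cantor_input).
have hP : size P = 16 by [].
have [[y ->]|nx] : (exists y, x = [:: y]) \/ size x <> 1%N.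
- by case: x => [|y [|]]; [right|left; exists y|right].
- rewrite /halts (@halts_iterD P _ _ [:: y] 4%N _ erefl) // hP.
  rewrite cantor_loopP //=; split=> [[w hw [<-]]//|h]; by exists y.
split=> [[w hw hx]|[t]]; first by rewrite -hx in nx.
have hl p s : onth P p = Some (Plain (JumpIdxLe 0 0 p)) -> pc s = p ->
    step (@no_oracle R) P [::] [::] s = s.
  by move=> e h; rewrite /step h e; case: s h => q ? ? ? /= ->; rewrite leqnn.
rewrite -/P hP => ht.
suff : (pc (run (@no_oracle R) P [::] [::] x t) < 16)%N by rewrite ltnNge ht.
pose I (s : config R) := s = init x \/ (pc s = 2%N \/ pc s = 4%N).
apply: (@never_halts _ 16 I) => [s hs|s|]; last by left.
  by rewrite /step onth_size // hP.
move=> [->|h]; last first.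
  split; first by case: h => ->.
  by exists 0%N; rewrite /= (_ : step _ _ _ _ _ = s) ?/I; [right|case: h; exact: hl].
split=> //; case: (ltnP 1 (size x)) => sx.
  by exists 1%N; right; left; rewrite /= /step /= leqNgt sx.
exists 2%N; right; right; rewrite /= /step /= sx /=.
by case: (size x) nx sx => [|[|]].
Qed.

(** The point is the only own constant, so the code is the single real [pair (pickle cantor_own) x].
    The load is repeated to fill the six places. *)
Definition cantor_own : control := cantor_loop [tuple of nseq 6 (Const 0 (Own 0))].

Lemma cantor_ownP (x : R) : halts cantor_own [:: x] [::] [::] <-> ~ cantor_third x.
Proof.
set P := map Plain cantor_own; have hP : size P = 16 by [].
rewrite /halts (@halts_iterD P _ _ [::] 6%N _ erefl) // hP.
by rewrite cantor_loopP.
Qed.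

End CantorMachine.

(** * Transcendental inputs *)

Section Transcendental.
Variable R : realType.
Implicit Types (D z x : seq R) (U : control).

Lemma poly_root_list (p : {poly R}) : p != 0 -> exists s : seq R, forall y, root p y -> y \in s.
Proof.
have [n] := ubnP (size p); elim: n p => // n IH p sp p0.
have [[a /factor_theorem[q qE]]|h] := pselect (exists a, root p a); last first.
  by exists [::] => y py; case: h; exists y.
have q0 : q != 0 by apply: contra_neq p0 => q0; rewrite qE q0 mul0r.
have [|s hs] := IH q _ q0.
  by move: sp; rewrite qE size_Mmonic ?monicXsubC // size_XsubC addn2.
exists (a :: s) => y; rewrite qE rootM root_XsubC inE orbC.
by move=> /orP[->//|/hs->]; rewrite orbT.
Qed.

(** There are countably many expressions, each nontrivial one with finitely many roots; a root is
    numbered by its expression and its position in the list. *)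
Lemma inalg_enum D : exists f : nat -> R, forall y, inalg D y -> exists n, f n = y.
Proof.
have /choice[s hs] : forall e, exists s : seq R, upoly D e != 0 ->
    forall y, root (upoly D e) y -> y \in s.
  move=> e; have [->|/poly_root_list[s hs]] := eqVneq (upoly D e) 0; last by exists s.
  by exists [::].
pose f n := if unpickle n is Some (e, i) then (s e)`_i else 0 : R.
exists f => y [e e0 en0].
have /(nthP 0)[i _ <-] : y \in s e.
  by apply: hs => //; apply/rootP; rewrite horner_upoly.
by exists (pickle (e, i)); rewrite /f pickleK.
Qed.

Lemma cantor_transcendental D : exists2 x, cantor_third x & ~ inalg D x.
Proof.
have [f hf] := inalg_enum D; have [x hx fx] := cantor_avoid f; exists x => //.
by move=> /hf[n]; exact: fx.
Qed.

Lemma cantor_complement_transcendental D (x delta : R) : cantor_third x -> 0 < delta ->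
  exists w, [/\ ~ cantor_third w, `|w - x| < delta & ~ inalg D w].
Proof.
move=> hx d0; have [f hf] := inalg_enum D.
have [w [hw wx fw]] := cantor_complement_avoid f hx d0; exists w; split=> //.
by move=> /hf[n]; exact: fw.
Qed.

(** The set [W] to which [near] is restricted for oracle machines, since only its points are
    conjugate over [D]. *)
Definition transcendental D : set (seq R) := [set w | exists2 r, w = [:: r] & ~ inalg D r].

Lemma transcendental_conjugate D x w :
  transcendental D x -> transcendental D w -> conjugate (D ++ x) (D ++ w).
Proof.
suff h x1 w1 e : transcendental D x1 -> transcendental D w1 ->
    peval (D ++ x1) e = 0 -> peval (D ++ w1) e = 0.
  move=> hx hw; split=> [|e]; last by split; exact: h.
  by case: hx hw => [r -> _] [r' -> _]; rewrite !size_cat.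
move=> [r -> nr] [r' -> _]; rewrite !cats1 => er.
have [u0|u0] := eqVneq (upoly D e) 0; last by case: nr; exists e.
by rewrite -horner_upoly u0 horner0.
Qed.

Lemma conjugate_subset D z a b : {subset z <= D} -> conjugate (D ++ a) (D ++ b) ->
  conjugate (z ++ a) (z ++ b).
Proof.
move=> zD [sab h]; split=> [|e].
  by apply/eqP; rewrite !size_cat eqn_add2l -(eqn_add2l (size D)) -!size_cat sab.
pose f i := if (i < size z)%N then index z`_i D else (size D + (i - size z))%N.
have fE c : peval (D ++ c) (prename f e) = peval (z ++ c) e.
  apply: peval_rename => i; rewrite /f !nth_cat; case: (ltnP i (size z)) => hi.
    have zi : z`_i \in D by rewrite zD ?mem_nth.
    by rewrite index_mem zi nth_index.
  by rewrite ltnNge leq_addr addKn.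
by rewrite -!fE.
Qed.

(* On the transcendental points close to [x], the vectors [F w] and [F x] of
   rational functions correspond under an isomorphism of [Q(D, w)] and [Q(D, x)]. *)
Lemma good_vector_conjugate D x F : transcendental D x ->
  good_vector D x (transcendental D) F ->
  near D x (transcendental D) (fun w => conjugate (D ++ F w) (D ++ F x)).
Proof.
move=> Tx [sF gF].
have /choice[n /choice[d nd]] := gF.
have d0 k : peval (D ++ x) (d k) != 0 by have [] := nd k.
have near_k m : near D x (transcendental D) (fun w => forall k, (k < m)%N ->
    (F w)`_k = peval (D ++ w) (n k) / peval (D ++ w) (d k)).
  elim: m => [|m IH]; first exact: near_true.
  apply: near_mono (near_and IH (nd m).2) => w _ [h1 h2] k.
  by rewrite ltnS leq_eqVlt => /orP[/eqP->|/h1].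
apply: near_mono (near_and sF (near_k (size (F x)))) => w Tw [sw hw].
have hx := near_self Tx (near_k (size (F x))).
have [_ xw] := transcendental_conjugate Tx Tw.
have neq0 e : peval (D ++ x) e != 0 -> peval (D ++ w) e != 0.
  by apply: contra_neq => /xw.
(* Substituting the quotients for the variables yields the same numerator and denominator
   expressions at [x] and at [w]. *)
have rat e : exists a b, [/\ peval (D ++ x) b != 0,
    peval (D ++ F x) e = peval (D ++ x) a / peval (D ++ x) b &
    peval (D ++ F w) e = peval (D ++ w) a / peval (D ++ w) b].
  elim: e => [i||a [n1 [d1 [h1 x1 w1]]] b [n2 [d2 [h2 x2 w2]]]
    |a [n1 [d1 [h1 x1 w1]]] b [n2 [d2 [h2 x2 w2]]]].
  - rewrite /= !nth_cat; case: (ltnP i (size D)) => hi.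
      exists (PVar i), POne; rewrite /= !divr1 oner_neq0; split=> //.
        by rewrite nth_cat hi.
      by rewrite nth_cat hi.
    case: (ltnP (i - size D) (size (F x))) => hi'.
      by exists (n (i - size D)%N), (d (i - size D)%N); rewrite hx // hw.
    exists PZero, POne; rewrite !pevalZero !mul0r /= oner_neq0 !nth_default ?sw //.
  - by exists POne, POne; rewrite /= !divr1 oner_neq0.
  - exists (PSub (PMul n1 d2) (PMul n2 d1)), (PMul d1 d2).
    by rewrite /= x1 x2 w1 w2 mulf_neq0 //; split=> //; field; rewrite ?h1 ?h2 ?neq0.
  - exists (PMul n1 n2), (PMul d1 d2).
    by rewrite /= x1 x2 w1 w2 mulf_neq0 // !mulf_div.
split=> [|e]; first by rewrite !size_cat sw.
have [a [b [b0 -> ->]]] := rat e.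
split=> /eqP; rewrite mulf_eq0 invr_eq0 (negPf (neq0 _ b0), negPf b0) orbF => /eqP h.
  by rewrite (xw a).2 // mul0r.
by rewrite (xw a).1 // mul0r.
Qed.

End Transcendental.

(** * Oracle answers on conjugate vectors *)

Section Oracles.
Variable R : realType.
Variables (pair : nat -> R -> R) (z : seq R) (U : control).
Hypothesis U_univ : universal pair z U.
Implicit Types (D x a b : seq R).

Lemma conjugate_size D a b : conjugate (D ++ a) (D ++ b) -> size a = size b.
Proof. by move=> [/eqP + _]; rewrite !size_cat eqn_add2l => /eqP. Qed.

Lemma conjugate_rank D a b : {subset z <= D} -> conjugate (D ++ a) (D ++ b) ->
  size (tbasis z a) = size (tbasis z b).
Proof. by move=> zD /(conjugate_subset zD); exact: conjugate_tbasis. Qed.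

Lemma conjugate_Ind D a b : {subset z <= D} -> conjugate (D ++ a) (D ++ b) ->
  Ind z a <-> Ind z b.
Proof.
move=> zD hab; rewrite !IndP !indepE (conjugate_rank zD hab).
by rewrite (conjugate_size hab).
Qed.

Lemma conjugate_eq D a b c c' i : conjugate (D ++ a) (D ++ b) ->
  (forall s, size s = size a -> peval (D ++ s) c = c') -> a`_i = c' -> (i < size a)%N -> b`_i = c'.
Proof.
move=> hab hc ai ia; have sab := conjugate_size hab; case: hab => _ hab.
have := (hab (PSub (PVar (size D + i)) c)).1.
rewrite /= !nth_cat ltnNge leq_addr addKn /= !hc // ai subrr => /(_ erefl) /eqP.
by rewrite subr_eq0 => /eqP.
Qed.

(** Being equal to an element of [D] is a polynomial relation. *)
Lemma conjugate_fixed D a b : {subset a <= D} -> conjugate (D ++ a) (D ++ b) -> b = a.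
Proof.
move=> aD hab; have sab := conjugate_size hab.
apply: (@eq_from_nth _ 0) => // i; rewrite -sab => ia.
have aiD : a`_i \in D by rewrite aD ?mem_nth.
apply: (conjugate_eq (c := PVar (index a`_i D)) hab) => // s _.
by rewrite /= nth_cat index_mem aiD nth_index.
Qed.

Lemma program_decides_inj p x y :
  program_decides U z p [set x] -> program_decides U z p [set y] -> x = y.
Proof.
move=> hx hy; have := returns_in_fun (hx x) (hy x); rewrite charfun_in // /charfun.
by case: asboolP => // _ [/eqP]; rewrite oner_eq0.
Qed.

Lemma exceptional_exists : exists x0, forall x,
  program_decides U z [::] [set x] -> x = x0.
Proof.
have [[x0 h]|h] := pselect (exists x, program_decides U z [::] [set x]).
  by exists x0 => x hx; exact: program_decides_inj hx h.
by exists [::] => x hx; case: h; exists x.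
Qed.

Section Invariance.
Variable D : seq R.
Hypothesis zD : {subset z <= D}.
(** Conjugacy preserves the transcendence degree, but it could move the vector singled out by the
    empty program; with entries in [D] that vector is fixed. *)
Hypothesis exceptional_D : forall x, program_decides U z [::] [set x] -> {subset x <= D}.

Lemma conjugate_Kd a b : conjugate (D ++ a) (D ++ b) -> Kd U z a = Kd U z b.
Proof.
move=> hab; rewrite !(KdE _ U_univ) (conjugate_rank zD hab).
have [ha|na] := pselect (program_decides U z [::] [set a]).
  by rewrite (conjugate_fixed (exceptional_D ha) hab).
rewrite (asboolF na); case: asboolP => // hb; case: na.
by rewrite (conjugate_fixed (exceptional_D hb) (conjugate_sym hab)).
Qed.

Lemma conjugate_Sd a b : conjugate (D ++ a) (D ++ b) -> Sd U z a -> Sd U z b.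
Proof.
move=> hab [x [k [m [ax Kx mk]]]]; have sab := conjugate_size hab.
have := hab; case/lastP: b sab hab => [|y c]; rewrite ax ?size_rcons // => -[sab] hab.
have -> : c = k%:R.
  have := @conjugate_eq D _ _ (pnat k) k%:R (size x) hab.
  rewrite !nth_rcons -sab ltnn eqxx size_rcons ltnSn; apply=> // s _.
  exact: peval_nat.
rewrite -!cats1 !catA => /conjugate_catl; rewrite !size_cat sab => /(_ erefl) hxy.
by exists y, k, m; split; rewrite ?cats1 // -(conjugate_Kd hxy).
Qed.

Definition good_oracle_at (O : oracle R) x := forall F, good_vector D x (transcendental D) F ->
  near D x (transcendental D) (fun w => O (F w) = O (F x)) /\
  (forall v, O (F x) = Some v -> forall k, good D x (transcendental D) (fun=> v`_k)).

Lemma good_oracle_set (L : set (seq R)) x : transcendental D x ->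
  (forall a b, conjugate (D ++ a) (D ++ b) -> L a -> L b) -> good_oracle_at (set_oracle L) x.
Proof.
move=> Tx hL F gF; split.
  apply: near_mono (good_vector_conjugate Tx gF) => w _ h.
  rewrite /set_oracle /charfun; congr (Some [:: if _ then _ else _]).
  by apply: asbool_equiv_eq; split; [exact: hL h|exact: hL (conjugate_sym h)].
move=> v [<-] [|k]; last by rewrite nth_default //; exact: (good_nat _ _ _ 0).
rewrite /charfun; case: `[< L (F x) >]; [exact: (good_nat _ _ _ 1)|exact: (good_nat _ _ _ 0)].
Qed.

Lemma good_oracle_Ind x : transcendental D x -> good_oracle_at (set_oracle (Ind z)) x.
Proof. by move=> Tx; apply: good_oracle_set => // a b /(conjugate_Ind zD) ->. Qed.

Lemma good_oracle_Sd x : transcendental D x -> good_oracle_at (set_oracle (Sd U z)) x.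
Proof. by move=> Tx; apply: good_oracle_set => //; exact: conjugate_Sd. Qed.

Lemma good_oracle_Kd x : transcendental D x -> good_oracle_at (natfun_oracle (Kd U z)) x.
Proof.
move=> Tx F gF; split.
  apply: near_mono (good_vector_conjugate Tx gF) => w _ h.
  by rewrite /natfun_oracle (conjugate_Kd h).
rewrite /natfun_oracle; case: (Kd U z (F x)) => //= n v [<-] [|k]; first exact: good_nat.
by rewrite nth_default //; exact: (good_nat _ _ _ 0).
Qed.

End Invariance.

(** The equation in [near] holds at all transcendental points as soon as it holds at [x], so only
    closeness restricts the choice of [w]. *)
Lemma near_cantor_complement D (x : R) Q : ~ inalg D x -> cantor_third x ->
  near D [:: x] (transcendental D) Q ->
  exists w, [/\ ~ inalg D w, ~ cantor_third w & Q [:: w]].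
Proof.
move=> nx Cx [e [eta [eta0 ex hQ]]].
have [w [Cw wx nw]] := cantor_complement_transcendental D Cx eta0.
exists w; split=> //; apply: hQ; first by exists w.
  by split=> // -[|k] //=; rewrite nth_nil subrr normr0.
have Tx : transcendental D [:: x] by exists x.
have Tw : transcendental D [:: w] by exists w.
exact: ((transcendental_conjugate Tx Tw).2 e).1 ex.
Qed.

Lemma cantor_not_semidecidable (O : oracle R) P c D : {subset c <= D} ->
  (forall x, transcendental D x -> good_oracle_at D O x) ->
  ~ (forall x, lang1 (@cantor_third R) x <-> halts_in O P c [::] x).
Proof.
move=> cD hO hP; have [x Cx nx] := cantor_transcendental D.
have Tx : transcendental D [:: x] by exists x.
have gF : good_vector D [:: x] (transcendental D) id.
  split; last by move=> k; exact: good_var.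
  by apply: near_true => w [r ->].
have hx : halts_in O P c [::] [:: x] by apply/hP; exists x.
have nD : {subset [::] <= D} by [].
have hw := halts_in_near Tx cD nD (hO _ Tx) gF hx.
have [w [_ Cw /hP[w' Cw' [ww]]]] := near_cantor_complement nx Cx hw.
by apply: Cw; rewrite -ww.
Qed.

Hypothesis pair_bss : bss_pairing pair.

(** [x != 0] excludes the empty list of constants, which [encode] represents by a dummy 0. *)
Lemma halting_cantor (x : R) : x != 0 ->
  halting_problem pair [:: pair (pickle cantor_own) x] <-> ~ cantor_third x.
Proof.
move=> x0; rewrite -cantor_ownP; split=> [[delta [c [[hx hc] hh]]]|h]; last first.
  by exists cantor_own, [:: x].
have [/(pcan_inj pickleK) hd xc] := pairing_inj pair_bss hx; rewrite hd.
case: c hc xc hh {hx} => [|a [|]] //= _ xc; last by rewrite xc.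
by rewrite xc eqxx in x0.
Qed.

Lemma good_vector_near D x W (F G : seq R -> seq R) : W x ->
  near D x W (fun w => F w = G w) -> good_vector D x W F -> good_vector D x W G.
Proof.
move=> Wx FG [sF gF]; split=> [|k].
  by apply: near_mono (near_and FG sF) => w _ [<- ->]; rewrite (near_self Wx FG).
by apply: good_near (gF k); apply: near_mono FG => w _ ->.
Qed.

(** The pairing is known only to be computable. A run of its machine near [x] shows that the code is
    locally a rational function of [x], once the constants [c1] of that machine belong to [D]. The
    answer 0 at [x] then persists at some [w] outside the Cantor set, whose program halts. *)
Lemma halting_not_decidable (O : oracle R) P c D0 :
  (forall D x, {subset D0 <= D} -> transcendental D x -> good_oracle_at D O x) ->
  ~ (forall x, returns_in O P c [::] x (charfun (halting_problem pair) x)).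
Proof.
move=> hO hP; have [M [c1 hM]] := pairing_computable pair_bss.
pose D := D0 ++ c ++ c1.
have D0D : {subset D0 <= D} by move=> u h; rewrite mem_cat h.
have cD : {subset c <= D} by move=> u h; rewrite !mem_cat h orbT.
have c1D : {subset c1 <= D} by move=> u h; rewrite !mem_cat h !orbT.
have nD : {subset [::] <= D} by [].
have [x Cx nx] := cantor_transcendental D.
have nz y : ~ inalg D y -> y != 0.
  move=> ny; apply/eqP => y0; apply: ny; rewrite y0.
  exists (PVar (size D)); first by rewrite /= nth_rcons ltnn eqxx.
  by rewrite /upoly /= nth_rcons size_map ltnn eqxx polyX_eq0.
have Tx : transcendental D [:: x] by exists x.
pose k := pickle cantor_own.
have gIn : good_vector D [:: x] (transcendental D) (fun w => [:: k%:R; w`_0]).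
  split; first exact: near_true.
  move=> [|[|i]]; [exact: good_nat|exact: good_var|].
  apply: good_near (good_nat _ _ _ 0); apply: near_true => w _.
  by rewrite nth_default.
have hN F : good_vector D [:: x] (transcendental D) F ->
    near D [:: x] (transcendental D) (fun w => @no_oracle R (F w) = @no_oracle R (F [:: x])) /\
    (forall v, @no_oracle R (F [:: x]) = Some v ->
      forall k, good D [:: x] (transcendental D) (fun=> v`_k)).
  by move=> _; split=> //; exact: near_true.
have [G [gG Gx hG]] := returns_in_near Tx c1D nD hN gIn (hM k x).
have gP : good_vector D [:: x] (transcendental D) (fun w => [:: pair k w`_0]).
  apply: good_vector_near Tx _ gG; apply: near_mono hG => w _ h.
  exact: returns_in_fun h (hM k _).
have := hP [:: pair k x]; rewrite charfun_out; last first.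
  by move=> /(halting_cantor (nz _ nx)).
move=> hx; have [H [gH Hx hH]] := returns_in_near Tx cD nD (hO D _ D0D Tx) gP hx.
have g0 i : good D [:: x] (transcendental D) (fun=> [:: 0]`_i).
  by case: i => [|i]; [|rewrite nth_default //]; exact: (good_nat _ _ _ 0).
have hw := near_and hH (good_vector_const Tx g0 gH Hx).
have [w [nw Cw [rw Hw]]] := near_cantor_complement nx Cx hw.
have := hP [:: pair k w]; rewrite charfun_in; last exact/(halting_cantor (nz _ nw)).
rewrite Hw in rw; move=> /(returns_in_fun rw) [/eqP].
by rewrite eq_sym oner_eq0.
Qed.

End Oracles.

(** * Complexity and independence *)

Section Reductions.
Variable R : realType.
Variables (pair : nat -> R -> R) (z : seq R) (U : control).
Hypothesis U_univ : universal pair z U.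
Implicit Types (x : seq R).

Lemma Sd_rcons x k : Sd U z (rcons x k%:R) <->
  program_decides U z [::] [set x] \/ ((0 < k) && (size (tbasis z x) <= k))%N.
Proof.
split=> [[x' [k' [m [/rcons_inj[<- /eqP]]]]]|h].
  rewrite eqr_nat (KdE _ U_univ) => /eqP <- [<-].
  by case: asboolP => [|_]; [left|rewrite geq_max; right].
exists x, k; rewrite (KdE _ U_univ); case: asboolP => hx; first by exists 0%N.
exists (maxn 1 (size (tbasis z x))); split=> //.
by case: h => // h; rewrite geq_max.
Qed.

(** A vector decided by the empty program is algebraic over [z], so its degree is 0 and the
    exception shows only at [k = 0]. *)
Lemma Sd_pos x k : (0 < k)%N -> Sd U z (rcons x k%:R) <-> (size (tbasis z x) <= k)%N.
Proof.
move=> k0; rewrite Sd_rcons k0 /=; split=> [[h|//]|]; last by right.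
suff -> : tbasis z x = [::] by [].
have := program_decides_inalg h; rewrite cats0 => {h}.
elim: x z => //= a x IH S h; rewrite asboolT; last by apply: h; rewrite mem_head.
apply: IH => b bx; apply: inalg_subset (h b _); last by rewrite inE bx orbT.
by move=> c; rewrite mem_rcons inE orbC => ->.
Qed.

Lemma Sd_dependent x : (1 < size x)%N -> Sd U z (rcons x (size x).-1%:R) <-> ~ Ind z x.
Proof.
move=> sx; rewrite Sd_pos; last by case: (size x) sx => [|[]].
rewrite IndP indepE; have h1 := size_tbasis z x.
rewrite -ltnS (ltn_predK sx) ltn_neqAle h1 andbT.
by split=> [/eqP|/eqP].
Qed.

Lemma independent_pair : exists c1 c2 : R, indep z [:: c1; c2].
Proof.
have [c1 _ h1] := cantor_transcendental z.
by have [c2 _ h2] := cantor_transcendental (rcons z c1); exists c1, c2.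
Qed.

(** If both [c1] and [c2] were algebraic over [z] and [a], then [steinitz] would bound two
    independent elements by one. *)
Lemma Ind_single (c1 c2 a : R) : indep z [:: c1; c2] ->
  Ind z [:: a] <-> (Ind z [:: a; c1] \/ Ind z [:: a; c2]).
Proof.
move=> hc; rewrite !IndP; split=> [ha|]; last by move=> [] [].
have [h1|n1] := pselect (indep z [:: a; c1]); first by left.
have [h2|n2] := pselect (indep z [:: a; c2]); first by right.
suff : (size [:: c1; c2] <= size [:: a])%N by [].
have cl c : ~ indep z [:: a; c] -> inalg (z ++ [:: a]) c.
  by move=> nc; apply: contrapT => hc'; apply: nc; rewrite cats1 in hc'; case: ha.
by apply: (steinitz hc) => c; rewrite !inE => /orP[/eqP->|/eqP->]; exact: cl.
Qed.

Definition bit (L : set (seq R)) x : R := if `[< L x >] then 1 else 0.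

(* Registers 1 and 2 hold 0 and 1, the index registers 1, 3, 4, 9 hold the size of the
   input, 1, 2 and 0. *)
Definition query_singleton (c : nat) : stmt :=
  seqs [:: storei 9 5; consti 6 (Own c); storei 3 6; storei 4 2; copyi 5 4; inci 5;
    Do (Query 9 5)].

(** No instruction moves an index into a real register, so [n - 1] is obtained by counting from 2 to
    the size [n]. *)
Definition size_minus_one := While (TIdx 7 1) (Seq (arithi Defs.Add 3 3 2) (inci 7)).

(** The empty vector is independent. For size 1 the vectors queried are [(a, c1, 1)] and
    [(a, c2, 1)]; the product of the answers is 1 iff both pairs are dependent. A longer vector is
    queried with its size minus one appended. *)
Definition independence : stmt := seqs [:: consti 2 One; copyi 1 0; inci 3; inci 4; inci 4;
  If (TIdx 1 9) (consti 0 One)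
    (If (TIdx 1 3)
      (seqs [:: fetchi 5 9; query_singleton 0; fetchi 7 9; query_singleton 1; fetchi 8 9;
        arithi Defs.Mul 7 7 8; arithi Defs.Sub 0 2 7])
      (seqs [:: copyi 7 4; size_minus_one; storei 1 3; copyi 8 1; inci 8; Do (Query 9 8);
        fetchi 7 9; arithi Defs.Sub 0 2 7]));
  return0].

Local Arguments size_minus_one : simpl never.

Lemma wp_size_minus_one O own host (Q : post R) (r m : nat -> R) (ix : nat -> nat) :
  ix 7%N = 2%N -> (1 < ix 1%N)%N ->
  r 3%N = 0 -> r 2%N = 1 ->
  (forall r' ix', r' 3%N = (ix 1%N).-1%:R -> r' 2%N = 1 ->
    (forall i : nat, i != 7%N -> ix' i = ix i) -> Q r' ix' m) ->
  wp O own host size_minus_one Q r ix m.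
Proof.
move=> i7 i1 r3 r2 hQ.
pose I n (r' : nat -> R) (ix' : nat -> nat) (m' : nat -> R) := [/\ m' = m,
  r' 2%N = 1, (forall i : nat, i != 7%N -> ix' i = ix i), (ix' 7%N + n = (ix 1%N).+1)%N &
  r' 3%N + n%:R = (ix 1%N).-1%:R].
apply: (@wp_while _ _ _ _ _ _ I _ (ix 1%N).-1) => [r' ix' m'|n r' ix' m'|].
- move=> [-> h2 hi h7 h3]; rewrite /= (hi 1%N) //; split; first by rewrite -ltnNge; lia.
  by apply: hQ => //; rewrite -h3 addr0.
- move=> [-> h2 hi h7 h3] /=; rewrite (hi 1%N) //; split; first by lia.
  split=> //=; first by move=> i i_n; rewrite (negPf i_n) hi.
    by rewrite addSnnS.
  by rewrite h2 -h3 -natr1 -addrA [1 + _]addrC.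
- by split=> //; [rewrite i7; lia|rewrite r3 add0r].
Qed.

Lemma segment_rcons s (v : R) :
  segment [eta nth 0 s with size s |-> v] 0 (size s).+1 = rcons s v.
Proof.
apply: (@eq_from_nth _ 0) => [|i]; rewrite size_map size_iota ?size_rcons // => hi.
rewrite (nth_map 0%N) ?size_iota // nth_iota // nth_rcons /=.
by case: (ltngtP i (size s)) => // h; rewrite nth_default // ltnW.
Qed.

Lemma Ind_decidable_in_Sd : bss_decidable_in (set_oracle (Sd U z)) (Ind z).
Proof.
have [c1 [c2 hc]] := independent_pair.
exists (compile 0 independence), [:: c1; c2] => x; apply: returns_wp.
have bitE (b : R) : b = bit (Ind z) x -> [:: b] = charfun (Ind z) x by move=> ->.
case: x bitE => [|a [|b x]] bitE.
- by rewrite /=; apply: bitE; rewrite /bit asboolT //; apply/IndP.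
- rewrite /=; apply: bitE.
  rewrite -[LHS]/(1 - bit (Sd U z) [:: a; c1; 1] * bit (Sd U z) [:: a; c2; 1]) /bit.
  rewrite (asbool_equiv_eq (Ind_single a hc)).
  rewrite !(asbool_equiv_eq (Sd_dependent (x := [:: a; _]) isT)) asbool_or !asbool_neg.
  by case: `[< Ind _ _ >]; case: `[< Ind _ _ >]; rewrite /= ?mul0r ?mulr0 ?mulr1 ?subr0 ?subrr.
rewrite /=; apply: wp_size_minus_one => //= r ix r3 r2 hix.
rewrite !hix //=; set s := [:: a, b & x] in bitE *.
have -> : (segment [eta nth 0 s with (size x).+2 |-> r 3%N] 0 (size x).+3) = rcons s (size s).-1%:R.
  by rewrite r3; refine (segment_rcons s (size s).-1%:R).
apply: bitE; rewrite /= r2 -[overwrite _ _ _ _]/(bit (Sd U z) _) /bit.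
rewrite (asbool_equiv_eq (Sd_dependent (x := s) isT)) asbool_neg.
by case: `[< Ind _ _ >]; rewrite /= ?subr0 ?subrr.
Qed.

Lemma tbasis_rcons (S x : seq R) a : tbasis S (rcons x a) =
  if `[< inalg (S ++ x) a >] then tbasis S x else rcons (tbasis S x) a.
Proof.
elim: x S => [|b x IH] S /=; first by rewrite cats0.
by rewrite IH cat_rcons; case: `[< inalg S b >]; case: `[< inalg _ a >].
Qed.

(** Over [z], the prefix and its basis have the same algebraic closure, so one query on the stored
    basis decides the greedy step. *)
Lemma Ind_tbasis x a : Ind z (rcons (tbasis z x) a) <-> ~ inalg (z ++ x) a.
Proof.
rewrite IndP indep_rcons; split=> [[_ h] h'|h].
  apply: h; apply: inalg_cut h' => c; rewrite mem_cat => /orP[cz|cx].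
    by apply: inalg_mem; rewrite mem_cat cz.
  exact: tbasis_span.
split; first exact: indep_tbasis.
move=> h'; apply: h; apply: inalg_subset h' => c; rewrite !mem_cat => /orP[->//|].
by move=> /mem_tbasis ->; rewrite orbT.
Qed.

(** Started at 0, it stops at the least natural number not below register 3. The two agree iff
    register 3 holds a natural number. *)
Definition count_up := While (TLt 4 3) (arithi Defs.Add 4 4 5).

Lemma wp_count_up O own host (Q : post R) (r m : nat -> R) (ix : nat -> nat) :
  r 4%N = 0 -> r 5%N = 1 ->
  (forall r' k, (forall i : nat, i != 4%N -> r' i = r i) -> r' 4%N = k%:R -> r 3%N <= k%:R ->
     (forall j : nat, r 3%N = j%:R -> r 3%N = k%:R) -> Q r' ix m) ->
  wp O own host count_up Q r ix m.
Proof.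
move=> r4 r5 hQ.
have ex : exists n, r 3%N <= n%:R.
  exists (Num.bound `|r 3%N|); apply: ltW.
  by apply: le_lt_trans (ler_norm _) _; exact: archi_boundP.
have [N hN Nmin] := ex_minnP ex.
pose I n (r' : nat -> R) (ix' : nat -> nat) (m' : nat -> R) := [/\ m' = m, ix' = ix,
  (forall i : nat, i != 4%N -> r' i = r i) & exists2 k, (k + n)%N = N & r' 4%N = k%:R].
apply: (@wp_while _ _ _ _ _ _ I _ N) => [r' ix' m'|n r' ix' m'|].
- move=> [-> -> hr [k]]; rewrite addn0 => -> h4 /=; rewrite h4 hr // ltNge hN; split=> //.
  apply: (hQ r' _ _ h4 hN) => // j hj; have := Nmin j; rewrite hj lexx => /(_ isT) jN.
  by apply/eqP; rewrite eq_le -hj hN hj ler_nat jN.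
- move=> [-> -> hr [k kN h4]] /=; rewrite h4 hr //; split.
    rewrite ltNge; apply/negP => /Nmin; rewrite -kN; lia.
  split=> //=; first by move=> i i4; rewrite (negPf i4) hr.
  by exists k.+1; rewrite ?addSnnS // hr // r5 -natr1.
- by split=> //; exists 0%N; rewrite ?r4.
Qed.

(* The [i]-th entry of the input, [i] in index register 2, is appended to the
   basis stored between the index registers 4 and 5 if it is independent of it. The
   answer of the oracle overwrites the first element of the basis, which is saved
   in register 8. *)
Definition rank_step := seqs [:: fetchi 7 2; storei 5 7; copyi 6 5; inci 6; fetchi 8 4;
  Do (Query 4 6); fetchi 9 4; storei 4 8;
  If (TLt 1 9) (seqs [:: inci 5; arithi Defs.Add 6 6 5]) Skip; inci 2; inci 3].

Definition rank_loop := While (TIdx 3 1) rank_step.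

Lemma wp_rank_loop own (Q : post R) x (r m : nat -> R) (ix : nat -> nat) :
  [/\ ix 1%N = size x, ix 2%N = 0, ix 3%N = 1, ix 4%N = (size x).+1 & ix 5%N = (size x).+1]%N ->
  [/\ r 1%N = 0, r 5%N = 1 & r 6%N = 0] -> (forall k, (k < size x)%N -> m k = x`_k) ->
  (forall r' ix' m', r' 6%N = (size (tbasis z x))%:R ->
    (forall i : nat, i != 6%N -> i != 7%N -> i != 8%N -> i != 9%N -> r' i = r i) ->
    ix' 9%N = ix 9%N -> Q r' ix' m') ->
  wp (set_oracle (Ind z)) own [::] rank_loop Q r ix m.
Proof.
move=> [i1 i2 i3 i4 i5] [r1 r5 r6] hm hQ.
pose n := size x.
(* [j] entries are left and [i] are done. The basis found so far lies in the cells from [n.+1] on,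
   since cell [n] belongs to the bound that follows [x] in the input. *)
pose I j (r' : nat -> R) (ix' : nat -> nat) (m' : nat -> R) := exists2 i, (i + j)%N = n &
  [/\ [/\ ix' 1%N = n, ix' 2%N = i, ix' 3%N = i.+1, ix' 4%N = n.+1 &
         ix' 5%N = (n.+1 + size (tbasis z (take i x)))%N],
      ix' 9%N = ix 9%N,
      r' 6%N = (size (tbasis z (take i x)))%:R /\
        (forall i : nat, i != 6%N -> i != 7%N -> i != 8%N -> i != 9%N -> r' i = r i),
      (forall k, (k < n)%N -> m' k = x`_k) &
      forall k, (k < size (tbasis z (take i x)))%N ->
        m' (n.+1 + k)%N = (tbasis z (take i x))`_k].
apply: (@wp_while _ _ _ _ _ _ I _ n) => [r' ix' m'|j r' ix' m'|].
- move=> [i]; rewrite addn0 => -> [[h1 _ h3 _ _] h9 [h6 hr] _ _] /=.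
  rewrite h1 h3 -ltnNge ltnSn; split=> //; apply: hQ => //.
  by rewrite h6 take_size.
- move=> [i ij [[h1 h2 h3 h4 h5] h9 [h6 hr] hm' hB]].
  have lt_in : (i < n)%N by lia.
  rewrite [holds_test _ _ _]/= h1 h3; split; first by [].
  set B := tbasis z (take i x) in h5 h6 hB.
  have seg : segment [eta m' with ix' 5%N |-> m' (ix' 2%N)] (ix' 4%N) (ix' 5%N).+1 = rcons B x`_i.
    rewrite h2 h4 h5 hm' //; apply: (@eq_from_nth _ 0) => [|k].
      by rewrite size_map size_iota size_rcons -addnS addKn.
    rewrite size_map size_iota -addnS addKn => hk; rewrite (nth_map 0%N) ?size_iota ?addKn //
      nth_iota ?addKn //.
    rewrite nth_rcons /= eqn_add2l; case: (ltngtP k (size B)) => [kB|kB|//].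
      exact: hB.
    by rewrite ltnS leqNgt kB in hk.
  have tE : tbasis z (take i.+1 x) = if `[< inalg (z ++ take i x) x`_i >] then B else rcons B x`_i.
    by rewrite (take_nth 0 lt_in) tbasis_rcons.
  rewrite /=; set m1 := [eta m' with _ |-> _] in seg *; rewrite seg.
  set v := charfun _ _; set m2 := overwrite m1 _ v.
  have sv : size v = 1%N by [].
  have m2E : m2 (ix' 4%N) = if `[< inalg (z ++ take i x) x`_i >] then 0 else 1.
    rewrite /m2 /overwrite leqnn sv addn1 ltnSn subnn /v /charfun /=.
    by rewrite (asbool_equiv_eq (Ind_tbasis _ _)) asbool_neg; case: `[< _ >].
  have m3E k : [eta m2 with ix' 4%N |-> m1 (ix' 4%N)] k = m1 k.
    rewrite /=; case: eqP => [->//|k4]; rewrite /m2 /overwrite sv.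
    by case: ifP => // hk; case: k4; lia.
  have m1E k : k != (n.+1 + size B)%N -> m1 k = m' k by rewrite /m1 /= h5 => /negPf ->.
  have m1B : m1 (n.+1 + size B)%N = x`_i by rewrite /m1 /= h5 eqxx h2 hm'.
  have hin k : (k < n)%N -> m1 k = x`_k by move=> hk; rewrite m1E ?hm' //; lia.
  have hr1 : r' 1%N = 0 by rewrite hr.
  have hr5 : r' 5%N = 1 by rewrite hr.
  set m3 := [eta m2 with _ |-> _] in m3E *; rewrite m2E hr1.
  move: tE; case: `[< _ >] => tE; rewrite ?ltxx ?ltr01.
    exists i.+1; first by rewrite addSnnS.
    rewrite tE; split=> //=.
    + by rewrite h1 h2 h3 h4 h5.
    + by split=> // k k6 k7 k8 k9; rewrite (negPf k9) (negPf k8) (negPf k7) hr.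
    + by move=> k hk; exact: etrans (m3E k) (hin k hk).
    + by move=> k hk; apply: etrans (m3E _) _; rewrite m1E ?hB // eqn_add2l (ltn_eqF hk).
  exists i.+1; first by rewrite addSnnS.
  rewrite tE size_rcons; split=> //=.
  + by rewrite h1 h2 h3 h4 h5 addnS.
  + split; first by rewrite h6 hr5 natr1.
    by move=> k k6 k7 k8 k9; rewrite (negPf k6) (negPf k9) (negPf k8) (negPf k7) hr.
  + by move=> k hk; exact: etrans (m3E k) (hin k hk).
  + move=> k hk; apply: etrans (m3E _) _; rewrite nth_rcons.
    move: hk; rewrite ltnS leq_eqVlt => /orP[/eqP->|hk].
      by rewrite m1B ltnn eqxx.
    by rewrite hk m1E ?hB // eqn_add2l (ltn_eqF hk).
- exists 0%N => //; rewrite take0 /= addn0; split=> //.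
Qed.

Local Arguments count_up : simpl never.
Local Arguments rank_loop : simpl never.
Local Arguments check_all : simpl never.

(** Register 0 first receives the answer for the empty program. It is cleared if the last entry is
    no natural number, and set to 1 if that entry is at least 1 and at least the rank; otherwise the
    first answer stands. *)
Definition complexity (o n : nat) (cs : seq (bool * pexp)) : stmt := seqs [::
  If (TIdx 0 9) Skip (seqs [:: copyi 1 0; deci 1; check_all 0 o n cs;
    consti 5 One; fetchi 3 1; arithi Defs.Sub 4 1 1; count_up;
    If (TLt 3 4) clear0 (seqs [:: copyi 2 9; copyi 3 9; inci 3; copyi 4 0; copyi 5 0;
      arithi Defs.Sub 6 1 1; rank_loop;
      If (TLt 3 5) Skip (If (TLt 3 6) Skip (consti 0 One))])]);
  return0].

(** The vector decided by the empty program is hard-wired through its entries as own constants. The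
    extra entry [v] is the bound stored behind [x]. *)
Lemma exceptional_conditions : exists (own : seq R) n cs, forall x (v : R),
  (size x == n) && all (holds own [::] (rcons x v)) cs = `[< program_decides U z [::] [set x] >].
Proof.
have [[x0 h0]|h] := pselect (exists x, program_decides U z [::] [set x]); last first.
  (* The condition 1 = 0 fails on every input. *)
  exists [::], 0%N, [:: (true, POne)] => x v.
  rewrite /= /holds /= oner_eq0 andbF asboolF // => hx; by apply: h; exists x.
exists x0, (size x0), [seq (true, PSub (PVar i) (PVar (size x0 + i))) | i <- iota 0 (size x0)].
move=> x v; rewrite all_map; apply/andP/asboolP => [[/eqP sx /allP h]|hx].
  suff -> : x = x0 by [].
  apply: (@eq_from_nth _ 0) => // i ix; have := h i; rewrite mem_iota add0n -sx => /(_ ix).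
  rewrite /holds /= !nth_cat -sx ix ltnNge leq_addr addKn /= nth_rcons ix.
  by rewrite subr_eq0 => /eqP.
rewrite (program_decides_inj hx h0) eqxx; split=> //; apply/allP => i.
rewrite mem_iota add0n /= => ix.
by rewrite /holds /= !nth_cat ix ltnNge leq_addr addKn /= nth_rcons ix subrr eqxx.
Qed.

Lemma Sd_decidable_in_Ind : bss_decidable_in (set_oracle (Ind z)) (Sd U z).
Proof.
have [own [n [cs hcs]]] := exceptional_conditions.
exists (compile 0 (complexity (size own) n cs)), own => w; apply: returns_wp.
have bitE (b : R) : b = bit (Sd U z) w -> [:: b] = charfun (Sd U z) w by move=> ->.
case/lastP: w bitE => [|x c] bitE.
  rewrite /=; apply: bitE; rewrite /bit asboolF // => -[x [k [m [e _ _]]]].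
  by case: x e.
rewrite /= size_rcons /=.
apply: (@wp_check_all _ _ own [::] _ _ _ _ _ _ (rcons x c)) => //= r ix r0 r1 hix.
rewrite !hix //= nth_rcons ltnn eqxx.
apply: wp_count_up => //=; first by rewrite r1 subrr.
move=> r' k hr h4 ck cnat.
have ix9 : ix 9%N = 0%N by rewrite hix.
have hr3 : r' 3%N = c by rewrite hr.
have hr1 : r' 1%N = 0 by rewrite hr.
have hr0 : r' 0%N = if `[< program_decides U z [::] [set x] >] then 1 else 0.
  by rewrite hr // -(hcs x c) r0.
rewrite hr3 h4; case: ifP => ck'.
  rewrite /= ix9; apply: bitE; rewrite hr1 subrr /bit asboolF //.
  move=> -[x' [j [m [/rcons_inj[_ cj] _ _]]]].
  by move: ck'; rewrite (cnat j cj) ltxx.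
have {ck} ck : c = k%:R.
  by apply/eqP; rewrite eq_le ck leNgt ck'.
rewrite /=; apply: (@wp_rank_loop own _ x).
- by rewrite /= ix9; split=> //; rewrite hix.
- by rewrite /= hr1 subrr hr.
- by move=> j hj; rewrite nth_rcons hj.
move=> r2 ix2 m2 h6 hr2 i9; rewrite /= ix9 in i9.
have r20 : r2 0%N = if `[< program_decides U z [::] [set x] >] then 1 else 0 by rewrite hr2.
have -> : r2 3%N = k%:R by rewrite hr2 //= hr3.
have -> : r2 5%N = 1%:R by rewrite hr2 //= hr.
rewrite i9 h6 !ltr_nat ck r20 in bitE *.
have bE : bit (Sd U z) (rcons x k%:R) = if `[< program_decides U z [::] [set x] >]
    || ((0 < k) && (size (tbasis z x) <= k))%N then 1 else 0.
  by rewrite /bit (asbool_equiv_eq (Sd_rcons x k)) asbool_or asboolb.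
rewrite bE in bitE.
case: (ltnP k 1) => k1.
  by apply: bitE; rewrite [(0 < k)%N]ltnNge (k1 : (k <= 0)%N) orbF.
case: (ltnP k _) => hk; apply: bitE; first by rewrite [(size _ <= k)%N]leqNgt hk andbF orbF.
by rewrite [(0 < k)%N]k1 hk orbT.
Qed.

End Reductions.

Theorem theorem3 (R : realType) (pair : nat -> R -> R)
    (pair_bss : bss_pairing pair) (z : seq R) (U : control)
    (U_univ : universal pair z U) :
  [/\ (* (a) *)
      bss_decidable_in (set_oracle (Ind z)) (Sd U z) /\
      bss_decidable_in (set_oracle (Sd U z)) (Ind z),
      (* (b) *)
      bss_semidecidable (lang1 (~` @cantor_third R)),
      (* (c) *)
      ~ bss_semidecidable (lang1 (@cantor_third R)) /\
      ~ bss_semidecidable_in (set_oracle (Ind z)) (lang1 (@cantor_third R)) &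
      (* (d) *)
      ~ bss_decidable_in (set_oracle (Sd U z)) (halting_problem pair) /\
      ~ bss_decidable_in (natfun_oracle (Kd U z)) (halting_problem pair)].
Proof.
have [x0 hx0] := exceptional_exists z U.
split.
- split; first exact: Sd_decidable_in_Ind U_univ.
  exact: Ind_decidable_in_Sd U_univ.
- exact: cantor_complement_semidecidable.
- split=> [[M [c hM]]|[P [c hP]]].
    (* A machine without oracle is treated as one whose queries are never answered. *)
    apply: (@cantor_not_semidecidable _ (@no_oracle R) (map Plain M) c c _ _ hM) => // x Tx F gF.
    by split=> //; exact: near_true.
  apply: (@cantor_not_semidecidable _ (set_oracle (Ind z)) P c (z ++ c) _ _ hP) => [a ac|x Tx].
    by rewrite mem_cat ac orbT.
  by apply: good_oracle_Ind => // a az; rewrite mem_cat az.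
(* The constants contain [z] and the exceptional vector [x0], as the invariance of [Kd] under
   conjugacy requires. *)
have zD D : {subset z ++ x0 <= D} -> {subset z <= D}.
  by move=> sub a az; apply: sub; rewrite mem_cat az.
have xD D : {subset z ++ x0 <= D} -> forall x, program_decides U z [::] [set x] -> {subset x <= D}.
  by move=> sub x /hx0 -> a ax; apply: sub; rewrite mem_cat ax orbT.
split=> -[P [c hP]].
  apply: (halting_not_decidable pair_bss (D0 := z ++ x0) _ hP) => D x sub Tx.
  by apply: (good_oracle_Sd U_univ) => //; [exact: zD|exact: xD].
apply: (halting_not_decidable pair_bss (D0 := z ++ x0) _ hP) => D x sub Tx.
by apply: (good_oracle_Kd U_univ) => //; [exact: zD|exact: xD].
Qed.
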